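(* Let $1\le p<\infty$, $1\le\alpha\le2$, and $\alpha<n$. There exists a constant $C=C(n,\alpha)>0$ such that, if $V\in\tilde S_{\alpha,p}(\mathbb{R}^n)$, then $$\int_{B(x_0,r_0)}|V(x)|^p|u(x)|^\alpha\,dx\le C\,[\eta_{\alpha,p}V(r_0)]^p\int_{B(x_0,r_0)}|\nabla u(x)|^\alpha\,dx$$ for every ball $B_0:=B(x_0,r_0)\subseteq\mathbb{R}^n$ and every $u\in C_0^\infty(\mathbb{R}^n)$ with ${\rm supp}(u)\subseteq B_0$.
   Context: For $0<\alpha<n$, $1\le p<\infty$ and $V\in L^p_{\rm loc}(\mathbb{R}^n)$, the Stummel $p$-modulus of $V$ is $$\eta_{\alpha,p}V(r):=\sup_{x\in\mathbb{R}^n}\left(\int_{|x-y|<r}\frac{|V(y)|^p}{|x-y|^{n-\alpha}}\,dy\right)^{1/p},\quad r>0.$$ The bounded Stummel modulus class is $\tilde S_{\alpha,p}=\tilde S_{\alpha,p}(\mathbb{R}^n):=\{V\in L^p_{\rm loc}(\mathbb{R}^n):\eta_{\alpha,p}V(r)<\infty\text{ for all }r>0\}$. $C_0^\infty(\mathbb{R}^n)$ denotes the smooth compactly supported functions on $\mathbb{R}^n$, and $B(x_0,r_0)$ is the open ball with center $x_0$ and radius $r_0$. *)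

(* Defs.v *)
From HB Require Import structures.
From mathcomp Require Import all_boot all_order all_algebra.
From mathcomp Require Import all_classical all_reals all_analysis.
From mathcomp Require Import measurable_realfun.

Set Implicit Arguments.
Unset Strict Implicit.
Unset Printing Implicit Defensive.

Import Order.TTheory GRing.Theory Num.Theory.
Import numFieldNormedType.Exports.

Local Open Scope classical_set_scope.
Local Open Scope ring_scope.

(* ['rV[R]_n] with its Borel sigma-algebra. *)
Notation borel_rV R n := (g_sigma_algebraType (@open 'rV[R]_n)).

Section lebesgue_rV.
Variable R : realType.

Definition cons_rV n (z : measurableTypeR R * borel_rV R n) :
  borel_rV R n.+1 := row_mx (const_mx z.1 : 'rV[R]_1) (z.2 : 'rV[R]_n).

(* Lebesgue measure on the Borel sets of R^n: a point mass on R^0, and the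
   product of the one-dimensional Lebesgue measure with that of R^n on R^n.+1. *)
Fixpoint lebesgue_rV n : set (borel_rV R n) -> \bar R :=
  match n return set (borel_rV R n) -> \bar R with
  | 0 => \d_((0 : 'rV[R]_0) : borel_rV R 0)
  | n'.+1 =>
      pushforward (@lebesgue_measure R \x @lebesgue_rV n')%E (@cons_rV n')
  end.

Lemma cons_rV0 n z : (@cons_rV n z : 'rV[R]_n.+1) 0 (lshift n (0 : 'I_1)) = z.1.
Proof. by apply: etrans (row_mxEl _ _ _ _) _; rewrite mxE. Qed.

Lemma cons_rVS n z (i : 'I_n) :
  (@cons_rV n z : 'rV[R]_n.+1) 0 (rshift 1 i) = (z.2 : 'rV[R]_n) 0 i.
Proof. exact: (row_mxEr (const_mx z.1 : 'rV[R]_1)). Qed.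

Lemma measurable_cons_rV n : measurable_fun setT (@cons_rV n).
Proof.
apply: (@measurability _ _ _ (borel_rV R n.+1) setT (@cons_rV n)
  (@open 'rV[R]_n.+1) erefl) => _ [U oU <-].
rewrite setTI.
pose B (i : rat * 'rV[rat]_n * nat) : set (measurableTypeR R * borel_rV R n) :=
  (ball (ratr i.1.1 : R) i.2.+1%:R^-1) `*`
  (ball (map_mx ratr i.1.2 : 'rV[R]_n) i.2.+1%:R^-1).
have -> : @cons_rV n @^-1` U =
    \bigcup_(i in [set i | B i `<=` @cons_rV n @^-1` U]) B i.
  apply/seteqP; split=> [[x v] /= Uxv|z [i /= Bi /Bi //]].
  have [e /= e0 eU] : exists2 e : R, 0 < e & ball (cons_rV (x, v) : 'rV[R]_n.+1) e `<=` U.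
    by apply/nbhs_ballP; exact: open_nbhs_nbhs.
  pose k := Num.truncn (2 / e).
  have k0 : 0 < k.+1%:R^-1 :> R by rewrite invr_gt0.
  have ke : k.+1%:R^-1 + k.+1%:R^-1 < e.
    have : 2 / e < k.+1%:R by exact: truncnS_gt.
    rewrite ltr_pdivrMr// => h.
    rewrite -[X in X < _]mulr2n -(mulr_natl _ 2).
    by rewrite ltr_pdivrMr// mulrC.
  have approx (y : R) : exists q : rat, ball (ratr q : R) k.+1%:R^-1 y.
    have : y - k.+1%:R^-1 < y + k.+1%:R^-1 by rewrite ltrD2l gtrN.
    move=> /rat_in_itvoo[q]; rewrite in_itv /= => /andP[h1 h2]; exists q.
    by rewrite /ball /= ltr_distl h1 h2.
  have [q hq] := approx x.
  have /choice[w hw] : forall i : 'I_n, exists q : rat,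
      ball (ratr q : R) k.+1%:R^-1 ((v : 'rV[R]_n) 0 i).
    by move=> i; exact: approx.
  exists (q, \row_i w i, k) => /=.
    move=> [y t] [/= yq [_ tw]]; apply: eU; split=> // i j; rewrite (ord1 i).
    case: (split_ordP (j : 'I_(1 + n))) => j' ->.
      rewrite (ord1 j') !cons_rV0 /=.
      by apply: (le_ball (ltW ke)); apply: (ball_triangle (ball_sym hq)).
    rewrite !cons_rVS /=.
    apply: (le_ball (ltW ke)).
    apply: (ball_triangle (ball_sym (hw j'))).
    by have := tw 0 j'; rewrite !mxE.
  split=> //=; split=> // i j; rewrite (ord1 i) !mxE; exact: hw.
rewrite bigcup_mkcond; apply: countable_bigcupT_measurable => // i.
case: ifPn => // _; apply: measurableX.
  exact: (measurable_ball (ratr i.1.1 : R)).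
by apply: sub_sigma_algebra; apply: ball_open; rewrite invr_gt0.
Qed.

Lemma cons_rV_ball n (k : nat) :
  @cons_rV n @^-1` ball (0 : 'rV[R]_n.+1) k.+1%:R =
  (ball (0 : R) k.+1%:R : set (measurableTypeR R)) `*`
  (ball (0 : 'rV[R]_n) k.+1%:R : set (borel_rV R n)).
Proof.
apply/seteqP; split=> [[x v]/= [_ h]|[x v]/= [hx [_ hv]]].
  split; first by have := h 0 (lshift n (0 : 'I_1)); rewrite cons_rV0 !mxE.
  split=> // i j; have := h 0 (rshift 1 j).
  by rewrite cons_rVS /= (ord1 i) !mxE.
split=> // i j; rewrite (ord1 i) mxE.
case: (split_ordP (j : 'I_(1 + n))) => j' ->.
  by rewrite (ord1 j') cons_rV0.
by rewrite cons_rVS /=; have := hv 0 j'; rewrite mxE.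
Qed.

Lemma measurable_ball_rV n (v : 'rV[R]_n) (r : R) :
  measurable (ball v r : set (borel_rV R n)).
Proof.
have [r0|r0] := ltP 0 r; last first.
  rewrite (_ : ball v r = set0) //; apply/seteqP; split=> // w [r0' _].
  by have := lt_le_trans r0' r0; rewrite ltxx.
by apply: sub_sigma_algebra; exact: ball_open.
Qed.

Lemma ball_rV_exhaust n :
  \bigcup_k (ball (0 : 'rV[R]_n) k.+1%:R) = [set: borel_rV R n].
Proof.
apply/seteqP; split=> // v _; exists (Num.truncn `|v : 'rV[R]_n|) => //.
by rewrite -ball_normE /ball_ /= sub0r normrN truncnS_gt.
Qed.

Lemma lebesgue_rV_sigma_finite n :
  exists mu : {sigma_finite_measure set (borel_rV R n) -> \bar R},
    mu = @lebesgue_rV n :> (set _ -> _) /\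
    forall k, (mu (ball (0 : 'rV[R]_n) k.+1%:R)%R < +oo)%E.
Proof.
elim: n => [|n [mu [muE mufin]]].
  exists (\d_((0 : 'rV[R]_0) : borel_rV R 0)); split=> // k.
  by rewrite /= diracE; case: (_ \in _); rewrite ltry.
pose m : {measure set (measurableTypeR R * borel_rV R n) -> \bar R} :=
  (@lebesgue_measure R \x mu)%E.
pose nu : set (borel_rV R n.+1) -> \bar R := fun A => m (@cons_rV n @^-1` A).
have mcons A : measurable A -> measurable (@cons_rV n @^-1` A).
  by move=> mA; rewrite -[X in measurable X]setTI; exact: measurable_cons_rV.
have nu0 : nu set0 = 0%E by rewrite /nu preimage_set0 measure0.
have nu_ge0 A : (0 <= nu A)%E by rewrite /nu measure_ge0.
have nu_sigma : semi_sigma_additive nu.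
  move=> F mF tF mUF; rewrite /nu preimage_bigcup.
  apply: measure_semi_sigma_additive.
  - by move=> k; exact: mcons.
  - apply/trivIsetP => /= i j _ _ ij; rewrite -preimage_setI.
    by move/trivIsetP : tF => /(_ _ _ _ _ ij) ->//; rewrite preimage_set0.
  - by rewrite -preimage_bigcup; exact: mcons.
have nu_fin k : (nu (ball (0 : 'rV[R]_n.+1) k.+1%:R)%R < +oo)%E.
  have mB : measurable (ball (0 : R) k.+1%:R : set (measurableTypeR R)).
    exact: (measurable_ball (0 : R)).
  rewrite /nu cons_rV_ball.
  rewrite [X in (X < _)%E](product_measure1E _ _ mB (measurable_ball_rV _ _)).
  have lB := lebesgue_measure_ball (0 : R) (ler0n R k.+1).
  by rewrite lte_mul_pinfty// [X in X \is a fin_num]lB.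
have nu_sf : sigma_finite setT nu.
  exists (fun k => ball (0 : 'rV[R]_n.+1) k.+1%:R); first by rewrite ball_rV_exhaust.
  by move=> k; split=> //; exact: measurable_ball_rV.
pose nuM := isMeasure.Build _ _ _ nu nu0 nu_ge0 nu_sigma.
pose nuT : {measure set (borel_rV R n.+1) -> \bar R} := HB.pack nu nuM.
pose nuS := Measure_isSigmaFinite.Build _ _ _ nuT nu_sf.
pose nuU : {sigma_finite_measure set (borel_rV R n.+1) -> \bar R} :=
  HB.pack nu nuM nuS.
exists nuU; split; [|exact: nu_fin].
rewrite [RHS](_ : _ = pushforward (@lebesgue_measure R \x @lebesgue_rV n)%E
  (@cons_rV n)) // -muE //.
Qed.

Let lebesgue_rV0 n : @lebesgue_rV n set0 = 0%E.
Proof. by have [mu [<- _]] := lebesgue_rV_sigma_finite n; rewrite measure0. Qed.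

Let lebesgue_rV_ge0 n A : (0 <= @lebesgue_rV n A)%E.
Proof.
by have [mu [<- _]] := lebesgue_rV_sigma_finite n; rewrite measure_ge0.
Qed.

Let lebesgue_rV_sigma_additive n : semi_sigma_additive (@lebesgue_rV n).
Proof.
have [mu [<- _]] := lebesgue_rV_sigma_finite n.
exact: measure_semi_sigma_additive.
Qed.

HB.instance Definition _ n := isMeasure.Build _ _ _ (@lebesgue_rV n)
  (@lebesgue_rV0 n) (@lebesgue_rV_ge0 n) (@lebesgue_rV_sigma_additive n).

Let lebesgue_rV_sigma_finiteT n : sigma_finite setT (@lebesgue_rV n).
Proof.
by have [mu [<- _]] := lebesgue_rV_sigma_finite n; exact: sigma_finiteT.
Qed.

HB.instance Definition _ n := Measure_isSigmaFinite.Build _ _ _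
  (@lebesgue_rV n) (@lebesgue_rV_sigma_finiteT n).

End lebesgue_rV.

Section stummel.
Variables (R : realType) (n : nat).
Implicit Types (x y : 'rV[R]_n) (u V : 'rV[R]_n -> R) (r alpha p : R).

(* The library's norm and balls on ['rV[R]_n] are those of the sup norm, hence
   the Euclidean ones below; the topology is the same. *)
Definition enorm x : R := Num.sqrt (\sum_(i < n) x 0 i ^+ 2).

Definition eball x r : set 'rV[R]_n := [set y | enorm (x - y) < r].

(* Measurable for the Lebesgue sigma-algebra of R^n, i.e., the completion of the
   Borel one. The integral against [lebesgue_rV] of a nonnegative function that
   is merely Lebesgue measurable is its usual Lebesgue integral, because it is
   the supremum over the Borel simple functions below it. *)
Definition lebesgue_measurable_fun V :=
  forall B : set (measurableTypeR R), measurable B ->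
    completed_algebra_gen (@lebesgue_rV R n) (V @^-1` B).

Definition Lp_loc p V :=
  lebesgue_measurable_fun V /\
  forall K : set 'rV[R]_n, compact K ->
    (\int[@lebesgue_rV R n]_(x in K) (`|V x| `^ p)%:E < +oo)%E.

(* At [y = x] the quotient is [0] by convention; this is a null set when
   [0 < n]. *)
Definition stummel_modulus alpha p V r : \bar R :=
  ereal_sup
    [set ((\int[@lebesgue_rV R n]_(y in eball x r)
             (`|V y| `^ p / enorm (x - y) `^ (n%:R - alpha))%:E) `^ p^-1)%E
    | x in [set: 'rV[R]_n]].

Definition bounded_stummel alpha p V :=
  Lp_loc p V /\ forall r, 0 < r -> (stummel_modulus alpha p V r < +oo)%E.

Definition partial (i : 'I_n) u : 'rV[R]_n -> R := 'D_(delta_mx 0 i) u.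

Definition grad u x : 'rV[R]_n := \row_i partial i u x.

(* All iterated partial derivatives exist and are continuous. *)
Definition smooth u :=
  forall s : seq 'I_n,
    continuous (foldr partial u s) /\
    forall i x, derivable (foldr partial u s) x (delta_mx 0 i).

Definition supp u : set 'rV[R]_n := closure [set x | u x != 0].

Definition test_function u := smooth u /\ compact (supp u).

End stummel.

(* Main.v *)
Require Import Defs.
From HB Require Import structures.
From mathcomp Require Import all_boot all_order all_algebra.
From mathcomp Require Import all_classical all_reals all_analysis.
From mathcomp Require Import measurable_realfun lra ring.

(** Let W be |V|^p on the ball B0 and 0 elsewhere, and let A be the supremum over y of the
    potential of order alpha of W, that is, of the integral of W(z) |y - z|^(alpha - n).

    The Stummel modulus at the single scale r0 controls A ([weight_potential]): A is at most
    a constant times its p-th power. Near y this is the definition. At distances at least r0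
    the kernel is at most r0^(alpha - n), and the mass of W is at most r0^(n - alpha) times
    the p-th power of the modulus, as the choice of the centre of B0 as y shows.

    A test function is controlled by its gradient ([subrepresentation]):
    |u(x)| is at most a constant times the integral of |grad u(y)| |x - y|^(1 - n). This
    comes from the fundamental theorem of calculus on half-lines, averaged over directions.

    It remains to show the trace inequality: X, the integral of W |u|^alpha, is at most a
    constant times A times the integral of |grad u|^alpha ([trace_inequality]). If alpha = 1,
    the representation of u and an exchange of integrals suffice. Otherwise put
    b = alpha - 1, which lies in ]0, 1]. Inserting the representation in one factor u bounds
    X by a multiple of the integral over y of |grad u(y)| F(y), where F(y) is the integral of
    |x - y|^(1 - n) |u(x)|^b W(x) over x ([duality_bound]). Fix y, and let U(x) be the
    integral of |z - y|^(1 - n) |u(z)| W(z) over the z no closer to y than x.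

    - Where |x - y|^(alpha - 2) U(x) < lam |grad u(y)|, a concavity argument on the sets
      {z : |z - y| >= |x - y|} bounds the contribution to F(y) by a multiple of
      (lam |grad u(y)|)^b A^(1 - b) ([tail_interpolation], [integral_le_of_tails]).
    - Elsewhere |grad u(y)| is at most lam^-1 |x - y|^(alpha - 2) U(x), and the gradient
      disappears ([threshold_split]). What is left is a triple integral in x, y and z over
      |x - y| <= |z - y|; integrated in y, the kernels compose to a multiple of
      |x - z|^(alpha - n) ([kernel_composition]), and the total is at most a multiple of
      lam^-1 A X ([interaction_bound]).

    Taking lam to be a large multiple of A absorbs the second contribution in X, which is
    finite, and turns the first one into a multiple of A times the integral of
    |grad u|^alpha.

    Two technical points. The kernels are those of the sup norm, which is comparable to the
    Euclidean one; its balls are cubes, of volume (2 r)^n. And V is only measurable for the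
    completed sigma-algebra; it is replaced by a Borel function equal to it off a null set
    ([borel_version]), which changes none of the integrals ([ge0_integral_eq_off_null]). *)

Set Implicit Arguments.
Unset Strict Implicit.
Unset Printing Implicit Defensive.
Import Order.TTheory GRing.Theory Num.Theory.
Import numFieldNormedType.Exports.
Local Open Scope classical_set_scope.
Local Open Scope ring_scope.

(** * Borel measurability on R^n *)

Section measurability.
Context {R : realType}.

Lemma open_measurable_rV n (U : set 'rV[R]_n) :
  open U -> measurable (U : set (borel_rV R n)).
Proof. by move=> oU; exact: sub_sigma_algebra. Qed.

Lemma continuous_measurable_rV n (f : 'rV[R]_n -> R) :
  continuous f -> measurable_fun setT (f : borel_rV R n -> measurableTypeR R).
Proof.
move=> cf.
apply: (@measurability _ _ (borel_rV R n) _ _ _ _ (RGenOpens.measurableE R)).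
move=> _ [_ [a [b ->]] <-]; rewrite setTI.
apply: open_measurable_rV; apply: open_comp => // x _; exact: cf.
Qed.

Lemma measurable_coord n (i : 'I_n) :
  measurable_fun setT (fun v : borel_rV R n => (v : 'rV[R]_n) 0 i).
Proof.
apply: (@continuous_measurable_rV n (fun v => v 0 i)).
exact: coord_continuous.
Qed.

(** Coordinates suffice because [cons_rV] is measurable from the product, so that the Borel
   sigma-algebra of R^n.+1 is no larger than the product one. *)
Lemma measurable_fun_rVP d (T : measurableType d) n (F : T -> borel_rV R n) :
  (forall i, measurable_fun setT (fun t => (F t : 'rV[R]_n) 0 i)) ->
  measurable_fun setT F.
Proof.
elim: n F => [|n IH] F mF.
  rewrite (_ : F = cst (0 : 'rV[R]_0)); first exact: measurable_cst.
  by apply/funext => t; apply/rowP => -[].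
pose G t : measurableTypeR R * borel_rV R n :=
  ((F t : 'rV[R]_(1 + n)) 0 (lshift n 0),
   \row_i ((F t : 'rV[R]_(1 + n)) 0 (rshift 1 i))).
have -> : F = @cons_rV R n \o G.
  apply/funext => t; apply/rowP => i /=.
  case: (split_ordP (i : 'I_(1 + n))) => j ->.
    by rewrite (ord1 j) cons_rV0.
  by rewrite cons_rVS mxE.
apply: (measurableT_comp (@measurable_cons_rV R n)).
apply: measurable_fun_pair; first exact: mF.
apply: IH => i; rewrite [X in measurable_fun _ X](_ : _ =
  (fun t => (F t : 'rV[R]_(1 + n)) 0 (rshift 1 i))); first exact: mF.
by apply/funext => t; rewrite mxE.
Qed.

Lemma measurable_dist d (T : measurableType d) n (F G : T -> borel_rV R n) :
  measurable_fun setT F -> measurable_fun setT G ->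
  measurable_fun setT (fun t => `|(F t : 'rV[R]_n) - (G t : 'rV[R]_n)|).
Proof.
move=> mF mG.
have mN : measurable_fun setT (fun v : borel_rV R n => `|v : 'rV[R]_n|).
  apply: (@continuous_measurable_rV n (fun v => `|v|)) => x.
  exact: norm_continuous.
apply: (measurableT_comp mN (_ : measurable_fun setT
   (fun t => ((F t : 'rV[R]_n) - (G t : 'rV[R]_n)) : borel_rV R n))).
apply: measurable_fun_rVP => i.
rewrite [X in measurable_fun _ X](_ : _ =
  (fun t => (F t : 'rV[R]_n) 0 i - (G t : 'rV[R]_n) 0 i)); last first.
  by apply/funext => t; rewrite !mxE.
apply: measurable_funB.
  exact: (measurableT_comp (measurable_coord i) mF).
exact: (measurableT_comp (measurable_coord i) mG).
Qed.

Lemma measurable_set1_rV n (x : 'rV[R]_n) : measurable [set x : borel_rV R n].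
Proof.
rewrite -(setCK [set x]); apply: measurableC; apply: open_measurable_rV.
by apply: closed_openC; apply: accessible_closed_set1; exact: hausdorff_accessible.
Qed.

Lemma measurable_enorm d (T : measurableType d) n (F : T -> 'rV[R]_n) :
  (forall i, measurable_fun setT (fun t => F t 0 i)) ->
  measurable_fun setT (fun t => enorm (F t)).
Proof.
move=> mF; apply: (measurableT_comp (continuous_measurable_fun (@sqrt_continuous R))).
by apply: measurable_sum => i; exact: measurable_funX.
Qed.

Lemma measurable_edist n (x : 'rV[R]_n) :
  measurable_fun setT (fun y : borel_rV R n => enorm (x - (y : 'rV[R]_n))).
Proof.
apply: measurable_enorm => i; rewrite [X in measurable_fun _ X](_ : _ =
    (fun y : borel_rV R n => x 0 i - (y : 'rV[R]_n) 0 i)).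
  by apply: measurable_funB => //; exact: measurable_coord.
by apply/funext => y; rewrite !mxE.
Qed.

Lemma measurable_eball n (x : 'rV[R]_n) (r : R) :
  measurable (eball x r : set (borel_rV R n)).
Proof.
rewrite -[X in measurable X]setTI.
have md := measurable_edist x.
have := md measurableT `]-oo, r[%classic (measurable_itv _).
by congr measurable; congr (_ `&` _); apply/seteqP; split=> y;
  rewrite /eball/= in_itv/=.
Qed.

End measurability.

(** * Lebesgue measure of R^n: Tonelli, affine substitution, balls *)

Section lebesgue_measure_Rn.
Context {R : realType}.
Local Open Scope ereal_scope.

Lemma lebesgue_rV_rec n (G : borel_rV R n.+1 -> \bar R) :
  measurable_fun setT G -> (forall v, 0 <= G v) ->
  \int[@lebesgue_rV R n.+1]_v G v =
  \int[@lebesgue_measure R]_a \int[@lebesgue_rV R n]_v G (cons_rV (a, v)).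
Proof.
move=> mG G0.
have -> : \int[@lebesgue_rV R n.+1]_v G v =
  \int[pushforward (@lebesgue_measure R \x @lebesgue_rV R n) (@cons_rV R n)]_v G v.
  by [].
rewrite ge0_integral_pushforward//; last exact: measurable_cons_rV.
rewrite preimage_setT fubini_tonelli1//=.
exact: (measurableT_comp mG (@measurable_cons_rV R n)).
Qed.

Lemma lebesgue_rV_ball n (v : 'rV[R]_n) (r : R) : (0 < r)%R ->
  @lebesgue_rV R n (ball v r) = ((2 * r) ^+ n)%:E.
Proof.
move=> r0; elim: n v => [|n IH] v.
  rewrite /= diracE mem_set ?expr0//; split=> // i [].
  by [].
pose v1 := (v : 'rV[R]_(1 + n)) 0%R (lshift n 0%R).
pose v2 : 'rV[R]_n := \row_i (v : 'rV[R]_(1 + n)) 0%R (rshift 1 i).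
have -> : @lebesgue_rV R n.+1 (ball v r) =
  (@lebesgue_measure R \x @lebesgue_rV R n)
    ((ball v1 r : set (measurableTypeR R)) `*` (ball v2 r : set (borel_rV R n))).
  transitivity ((@lebesgue_measure R \x @lebesgue_rV R n) (@cons_rV R n @^-1` ball v r)); first by [].
  apply: f_equal; apply/seteqP; split=> [[x w]/= [_ h]|[x w]/= [hx [_ hv]]].
    split; first by have := h 0%R (lshift n (0%R : 'I_1)); rewrite cons_rV0.
    split=> // i j; have := h 0%R (rshift 1 j).
    by rewrite cons_rVS /= (ord1 i) !mxE.
  split=> // i j; rewrite (ord1 i).
  case: (split_ordP (j : 'I_(1 + n))) => j' ->.
    by rewrite (ord1 j') cons_rV0.
  by rewrite cons_rVS /=; have := hv 0%R j'; rewrite mxE.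
have mB : measurable (ball v1 r : set (measurableTypeR R)).
  exact: (measurable_ball v1).
have E := product_measure1E (@lebesgue_measure R) (@lebesgue_rV R n) mB (measurable_ball_rV v2 r).
rewrite [LHS]E.
have E1 := lebesgue_measure_ball v1 (ltW r0).
transitivity ((r *+ 2)%:E * ((2 * r) ^+ n)%:E).
  by congr (_ * _); [exact: E1|exact: IH].
by rewrite -EFinM exprS (mulr_natl r 2).
Qed.

Lemma lebesgue_affine (c t : R) (G : measurableTypeR R -> \bar R) : (0 < t)%R ->
  measurable_fun setT G -> (forall v, 0 <= G v) ->
  \int[@lebesgue_measure R]_a G (c + t * a)%R =
  (t^-1)%:E * \int[@lebesgue_measure R]_a G a.
Proof.
move=> t0 mG G0.
pose phi (a : measurableTypeR R) : measurableTypeR R := (c + t * a)%R.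
have mphi : measurable_fun setT phi.
  apply: measurable_funD => //.
have [nu nuE] : exists nu : {measure set (measurableTypeR R) -> \bar R},
    nu = pushforward (@lebesgue_measure R) phi :> (set _ -> _).
  by unshelve eexists (pushforward (@lebesgue_measure R) phi); [exact: mphi|].
have tnn : (0 <= t)%R by exact: ltW.
pose s : {nonneg R} := NngNum tnn.
have E A : measurable A -> @lebesgue_measure R A = mscale s nu A.
  move=> mA; apply: lebesgue_measure_unique => //= _ [[a b]] _ <- /=.
  rewrite /mscale /= nuE /pushforward /=.
  have -> : phi @^-1` [set` `]a, b]%R] = [set` `](a - c) / t, (b - c) / t]%R].
    apply/seteqP; split=> z /=; rewrite !in_itv /= /phi.
      by rewrite ltr_pdivrMr// ler_pdivlMr// ltrBlDl lerBrDl [(z * t)%R]mulrC.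
    by rewrite ltr_pdivrMr// ler_pdivlMr// ltrBlDl lerBrDl [(z * t)%R]mulrC.
  rewrite !lebesgue_measure_itv /= !lte_fin ltr_pM2r ?invr_gt0// ltrD2r.
  case: ifPn => _; last by rewrite mule0.
  rewrite -!EFinB -EFinM; congr EFin.
  by rewrite -mulrBl opprB addrA subrK mulrCA divff ?mulr1// gt_eqF.
have -> : \int[@lebesgue_measure R]_a G (c + t * a)%R = \int[nu]_a G a.
  by rewrite nuE ge0_integral_pushforward.
have -> : \int[@lebesgue_measure R]_a G a = \int[mscale s nu]_a G a.
  by apply: eq_measure_integral => A mA _; exact: E.
rewrite ge0_integral_mscale//= muleA -EFinM mulVf ?mul1e// gt_eqF//.
Qed.

(** By induction on the dimension, one factor t^-1 for each coordinate. *)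
Lemma lebesgue_rV_affine n (c : 'rV[R]_n) (t : R) (G : borel_rV R n -> \bar R) : (0 < t)%R ->
  measurable_fun setT G -> (forall v, 0 <= G v) ->
  \int[@lebesgue_rV R n]_v G (c + t *: (v : 'rV[R]_n))%R =
  (t^-1 ^+ n)%:E * \int[@lebesgue_rV R n]_v G v.
Proof.
move=> t0; elim: n c G => [|n IH] c G mG G0.
  rewrite expr0 mul1e; apply: eq_integral => v _; congr G; apply/rowP => -[].
  by [].
have maff m (k : 'rV[R]_m) : measurable_fun setT
    (fun v : borel_rV R m => (k + t *: (v : 'rV[R]_m))%R : borel_rV R m).
  apply: measurable_fun_rVP => i.
  rewrite [X in measurable_fun _ X](_ : _ =
      (fun v : borel_rV R m => k 0%R i + t * (v : 'rV[R]_m) 0%R i))%R.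
    by apply: measurable_funD => //; apply: measurable_funM => //; exact: measurable_coord.
  by apply/funext => v; rewrite !mxE.
rewrite lebesgue_rV_rec//; last exact: (measurableT_comp mG (maff _ c)).
rewrite lebesgue_rV_rec//.
pose c1 := (c : 'rV[R]_(1 + n)) 0%R (lshift n 0%R).
pose c2 : 'rV[R]_n := \row_i (c : 'rV[R]_(1 + n)) 0%R (rshift 1 i).
have mGc : measurable_fun setT (G \o @cons_rV R n).
  exact: (measurableT_comp mG (@measurable_cons_rV R n)).
have E a v : (c + t *: (cons_rV (a, v) : 'rV[R]_n.+1))%R =
    cons_rV ((c1 + t * a)%R : measurableTypeR R, (c2 + t *: (v : 'rV[R]_n))%R : borel_rV R n).
  apply/rowP => i; case: (split_ordP (i : 'I_(1 + n))) => j ->.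
    rewrite (ord1 j) cons_rV0 /= mxE; congr (_ + _)%R.
    by rewrite mxE; congr (_ * _)%R; rewrite cons_rV0.
  rewrite cons_rVS /= mxE [in RHS]mxE; congr (_ + _)%R; first by rewrite mxE.
  by rewrite [LHS]mxE [RHS]mxE; congr (_ * _)%R; rewrite cons_rVS.
transitivity (\int[@lebesgue_measure R]_a ((t^-1 ^+ n)%:E *
    \int[@lebesgue_rV R n]_v G (cons_rV ((c1 + t * a)%R : measurableTypeR R, v)))).
  apply: eq_integral => a _; under eq_integral do rewrite E.
  rewrite (IH c2 (fun v => G (cons_rV ((c1 + t * a)%R : measurableTypeR R, v))))//.
  exact: (measurable_fun_pair2 _ mGc).
have mF : measurable_fun setT (fun a : measurableTypeR R =>
    \int[@lebesgue_rV R n]_v G (cons_rV (a, v))).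
  by apply: (measurable_fun_fubini_tonelli_F (m2 := @lebesgue_rV R n) (G \o @cons_rV R n)) => // x; exact: G0.
have tn0 : (0 <= t^-1 ^+ n)%R by rewrite exprn_ge0// invr_ge0 ltW.
rewrite ge0_integralZl//; last 2 first.
- apply: (measurableT_comp mF (_ : measurable_fun setT (fun a : measurableTypeR R => (c1 + t * a)%R : measurableTypeR R))).
  exact: measurable_funD.
- by move=> x _; exact: integral_ge0.
rewrite (lebesgue_affine c1 t0 mF); last by move=> x; exact: integral_ge0.
by rewrite muleA -EFinM -exprSr.
Qed.

End lebesgue_measure_Rn.

Section points_are_null.
Context {R : realType}.

Lemma lebesgue_rV_set1 n (x : 'rV[R]_n) : (0 < n)%N ->
  @lebesgue_rV R n [set x : borel_rV R n] = 0%E.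
Proof.
move=> n0; apply/eqP; rewrite eq_le measure_ge0 andbT.
apply/lee_addgt0Pr => e e0; rewrite add0e.
pose r : R := Num.min e 1 / 2.
have r0 : 0 < r by rewrite divr_gt0// lt_min e0 ltr01.
apply: (@le_trans _ _ (@lebesgue_rV R n (ball x r))).
  apply: le_measure; rewrite ?inE//.
  - exact: measurable_set1_rV.
  - exact: measurable_ball_rV.
  - by move=> _ ->; exact: ballxx.
have E := lebesgue_rV_ball x r0.
rewrite [leLHS]E lee_fin /r mulrC divfK//.
have m1 : Num.min e 1 <= 1 by rewrite ge_min lexx orbT.
rewrite -(prednK n0) exprS (@le_trans _ _ (Num.min e 1))//; last by rewrite ge_min lexx.
by rewrite ler_piMr ?exprn_ile1// le_min ?ltW.
Qed.

End points_are_null.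

(** * Real powers and norms *)

Lemma le_of_eq d (T : porderType d) (x y : T) : x = y -> (x <= y)%O.
Proof. by move->. Qed.

Section powR_extra.
Context {R : realType}.
Implicit Types a b s : R.

Lemma powRN_anti s a b : 0 <= s -> 0 < a -> a <= b -> b `^ (- s) <= a `^ (- s).
Proof.
move=> s0 a0 ab; have b0 := lt_le_trans a0 ab.
rewrite !powRN lef_pV2 ?posrE ?powR_gt0//.
by apply: ge0_ler_powR => //; rewrite nnegrE ltW.
Qed.

Lemma powR_exprn a s k : 0 <= a -> (a ^+ k) `^ s = (a `^ s) ^+ k.
Proof. by move=> a0; rewrite -powR_mulrn// powRAC powR_mulrn// powR_ge0. Qed.

Lemma powR_lt1 a s : 0 < a < 1 -> 0 < s -> a `^ s < 1.
Proof.
move=> /andP[a0 a1] s0; have -> : 1 = 1 `^ s :> R by rewrite powR1.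
by apply: gt0_ltr_powR; rewrite ?nnegrE// ltW.
Qed.

(** Compare s with t. For b = alpha - 1, this sublinearity is where alpha <= 2 is essential. *)
Lemma powR_concave_le s t b : 0 <= s -> 0 < t -> 0 < b <= 1 ->
  s `^ b <= t `^ (b - 1) * s + t `^ b.
Proof.
move=> s0 t0 /andP[b0 b1]; have [st|ts] := leP s t.
  rewrite -[leLHS]add0r lerD ?mulr_ge0 ?powR_ge0//.
  by apply: ge0_ler_powR; rewrite ?nnegrE// ltW.
rewrite -[leLHS]addr0 lerD ?powR_ge0// -(mulr_powRB1 s0 b0) mulrC ler_wpM2r//.
by rewrite -(opprB 1 b) powRN_anti ?subr_ge0// ltW.
Qed.

End powR_extra.

Section sup_norm.
Context {R : realType} {n : nat}.

Lemma ler_coord_norm (v : 'rV[R]_n) i : `|v 0 i| <= `|v|.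
Proof.
by rewrite [leRHS]/Num.Def.normr/= mx_normrE; apply/bigmax_geP; right => /=; exists (0, i).
Qed.

Lemma norm_ler_coord (v : 'rV[R]_n) c : 0 <= c -> (forall i, `|v 0 i| <= c) -> `|v| <= c.
Proof.
move=> c0 vc; rewrite [leLHS]/Num.Def.normr/= mx_normrE; apply: bigmax_le => //.
by move=> -[i j] _ /=; rewrite (ord1 i).
Qed.

Lemma enorm_ge0 (v : 'rV[R]_n) : 0 <= enorm v.
Proof. exact: sqrtr_ge0. Qed.

Lemma ler_coord_enorm (v : 'rV[R]_n) i : `|v 0 i| <= enorm v.
Proof.
rewrite /enorm -sqrtr_sqr; apply: ler_wsqrtr.
by rewrite (bigD1 i)//= lerDl; apply: sumr_ge0 => j _; exact: sqr_ge0.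
Qed.

Lemma norm_le_enorm (v : 'rV[R]_n) : `|v| <= enorm v.
Proof.
apply: norm_ler_coord; first exact: enorm_ge0.
exact: ler_coord_enorm.
Qed.

Lemma enorm_le_norm (v : 'rV[R]_n) : (0 < n)%N -> enorm v <= n%:R * `|v|.
Proof.
move=> n0; have nv0 : 0 <= n%:R * `|v| by rewrite mulr_ge0.
rewrite -[leRHS](ger0_norm nv0) -sqrtr_sqr; apply: ler_wsqrtr.
apply: (@le_trans _ _ (\sum_(i < n) `|v| ^+ 2)).
  apply: ler_sum => i _; rewrite -(@real_normK _ (v 0 i)) ?num_real//.
  by rewrite lerXn2r ?nnegrE// ler_coord_norm.
rewrite sumr_const card_ord exprMn -[leLHS]mulr_natl ler_wpM2r ?exprn_ge0//.
by rewrite -natrX ler_nat -mulnn leq_pmulr.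
Qed.

(** The passage from the kernels of the Stummel modulus, which are Euclidean, to those used in
   the estimates. *)
Lemma norm_powRN_le (v : 'rV[R]_n) (s : R) : (0 < n)%N -> 0 < s ->
  `|v| `^ (- s) <= n%:R `^ s / enorm v `^ s.
Proof.
move=> n0 s0; have nR : 0 < n%:R :> R by rewrite ltr0n.
have [v0|v0] := eqVneq (enorm v) 0.
  have -> : `|v| = 0 by apply/eqP; rewrite eq_le normr_ge0 andbT -v0 norm_le_enorm.
  by rewrite powR0 ?oppr_eq0 ?gt_eqF// divr_ge0// powR_ge0.
have ev : 0 < enorm v by rewrite lt_def v0 sqrtr_ge0.
apply: (@le_trans _ _ ((enorm v / n%:R) `^ (- s))).
  apply: powRN_anti; [exact: ltW|exact: divr_gt0|].
  by rewrite ler_pdivrMr// mulrC enorm_le_norm.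
rewrite powRM ?invr_ge0 ?(ltW ev) ?(ltW nR)// !powRN mulrC.
by rewrite -[in n%:R^-1]powR_inv1 ?(ltW nR)// -powRrM mulN1r powRN invrK.
Qed.

End sup_norm.

(** * Integrals of nonnegative functions *)

Section nonnegative_integrals.
Local Open Scope ereal_scope.
Context d (T : measurableType d) (R : realType) (mu : {measure set T -> \bar R}).

Lemma integral_bool_restrict (b : T -> bool) (g : T -> R) :
  \int[mu]_(t in [set t | b t]) (g t)%:E = \int[mu]_t ((b t)%:R * g t)%:E.
Proof.
rewrite integral_mkcond; apply: eq_integral => t _; rewrite patchE.
case: ifPn => [/set_mem/= ->|]; first by rewrite mul1r.
by rewrite notin_setE/= => /negP/negbTE ->; rewrite mul0r.
Qed.

Lemma ge0_integralTZl (k : R) (f : T -> \bar R) : (0 <= k)%R ->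
  measurable_fun setT f -> (forall t, 0 <= f t) ->
  \int[mu]_t (k%:E * f t) = k%:E * \int[mu]_t f t.
Proof. by move=> k0 mf f0; rewrite ge0_integralZl. Qed.

Lemma ge0_le_integralT (f g : T -> \bar R) :
  measurable_fun setT f -> measurable_fun setT g -> (forall t, 0 <= f t) ->
  (forall t, f t <= g t) -> \int[mu]_t f t <= \int[mu]_t g t.
Proof. by move=> mf mg f0 fg; apply: ge0_le_integral. Qed.

Lemma ge0_integral_lin (D : set T) (a b : R) (g h : T -> R) : measurable D ->
  (0 <= a)%R -> (0 <= b)%R ->
  measurable_fun setT g -> measurable_fun setT h ->
  (forall t, 0 <= g t)%R -> (forall t, 0 <= h t)%R ->
  \int[mu]_(t in D) (a * g t + b * h t)%:E =
  a%:E * \int[mu]_(t in D) (g t)%:E + b%:E * \int[mu]_(t in D) (h t)%:E.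
Proof.
move=> mD a0 b0 mg mh g0 h0.
have mgD : measurable_fun D (EFin \o g) by apply: measurable_funTS; exact/measurable_EFinP.
have mhD : measurable_fun D (EFin \o h) by apply: measurable_funTS; exact/measurable_EFinP.
have g0D t : D t -> 0 <= (EFin \o g) t by move=> _; rewrite lee_fin.
have h0D t : D t -> 0 <= (EFin \o h) t by move=> _; rewrite lee_fin.
have a0E : 0 <= a%:E by rewrite lee_fin.
have b0E : 0 <= b%:E by rewrite lee_fin.
rewrite -(ge0_integralZl mu mD mgD g0D a0E) -(ge0_integralZl mu mD mhD h0D b0E).
rewrite -ge0_integralD //.
- by move=> t Dt; exact: mule_ge0 (g0D t Dt).
- exact: measurable_funeM.
- by move=> t Dt; exact: mule_ge0 (h0D t Dt).
- exact: measurable_funeM.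
Qed.

Lemma ge0_integral_setC (S : set T) (f : T -> \bar R) : measurable S ->
  measurable_fun setT f -> (forall t, 0 <= f t) ->
  \int[mu]_t f t = \int[mu]_(t in S) f t + \int[mu]_(t in ~` S) f t.
Proof.
move=> mS mf f0; have mSC : measurable (~` S) by exact: measurableC.
have dS : [disjoint S & ~` S] by apply/disj_set2P; rewrite setICr.
have mfU : measurable_fun (S `|` ~` S) f by exact: measurable_funTS.
by rewrite -(ge0_integral_setU mu mS mSC mfU (fun t _ => f0 t) dS) setUv.
Qed.

Lemma measurable_fun_bool_real (b : T -> bool) :
  measurable_fun setT b -> measurable_fun setT (fun t => (b t)%:R : R).
Proof.
move=> mb; rewrite [X in measurable_fun _ X](_ : _ =
  (fun t => if b t then 1 else 0 : R)%R); last by apply/funext => t; case: (b t).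
exact: measurable_fun_ifT.
Qed.

(** Dyadic summation: where f is nonzero, it is dominated by the sum of the simple functions
   c k * \1_(B k), whose integrals form a geometric series. *)
Lemma integral_le_geometric (D : set T) (f : T -> \bar R) (B : nat -> set T)
    (c v : nat -> R) (M q : R) : measurable D -> measurable_fun D f ->
  (forall t, D t -> 0 <= f t) -> (forall k, measurable (B k)) ->
  (forall k, (0 <= c k)%R) -> (forall k, mu (B k) <= (v k)%:E) ->
  (forall t, D t -> f t != 0 -> exists2 k, B k t & f t <= (c k)%:E) ->
  (0 <= M)%R -> (0 < q < 1)%R ->
  (forall k, (c k * v k <= M * q ^+ k)%R) ->
  \int[mu]_(t in D) f t <= (M / (1 - q))%:E.
Proof.
move=> mD mf f0 mB c0 muB fB M0 /andP[q0 q1] cv.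
pose g k (t : T) : \bar R := (c k)%:E * (\1_(B k) t)%:E.
have mg k : measurable_fun setT (g k).
  by apply: measurable_funeM; apply/measurable_EFinP; exact: measurable_indic.
have g0 k t : 0 <= g k t by rewrite mule_ge0// lee_fin.
apply: (@le_trans _ _ (\int[mu]_(t in D) \sum_(0 <= k <oo) g k t)).
  apply: ge0_le_integral => //.
    apply: (ge0_emeasurable_sum (P := xpredT)) => [k t _ _|k _]; first exact: g0.
    exact: measurable_funTS.
  move=> t Dt; have [->|ft0] := eqVneq (f t) 0; first exact: nneseries_ge0.
  have [k Bk fk] := fB t Dt ft0; apply: (le_trans fk).
  apply: le_trans (nneseries_lim_ge k.+1 _) => //.
  rewrite big_nat_recr//= {2}/g indicE mem_set// mule1 leeDr//.
  by apply: sume_ge0 => i _; exact: g0.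
rewrite integral_nneseries//; last by move=> k; exact: measurable_funTS.
have le1 k : \int[mu]_(t in D) g k t <= (geometric M q k)%:E.
  apply: (@le_trans _ _ (\int[mu]_t g k t)).
    by apply: ge0_subset_integral.
  rewrite ge0_integralZl//; last 2 first.
  - by apply/measurable_EFinP; exact: measurable_indic.
  - by rewrite lee_fin.
  rewrite integral_indic// setIT (le_trans (lee_wpmul2l _ (muB k)))// ?lee_fin//.
apply: (@le_trans _ _ (\sum_(0 <= k <oo) (geometric M q k)%:E)).
  by apply: lee_nneseries => // k _ _; exact: integral_ge0.
apply: lime_le.
  by apply: is_cvg_nneseries => k _ _; rewrite lee_fin geometric_ge0// ltW.
near=> m; rewrite sumEFin lee_fin; apply: geometric_le_lim => //.
by rewrite ger0_norm// ltW.
Unshelve. all: by end_near. Qed.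

(** The tails {t : rho s <= rho t} are totally ordered by inclusion, so that S is covered by
   one of them or by the union of an increasing sequence of them, with s in S. *)
Lemma integral_le_of_tails (g : T -> \bar R) (rho : T -> R) (S : set T) (c : \bar R) :
  measurable_fun setT g -> (forall t, 0 <= g t) ->
  measurable_fun setT rho -> (forall t, 0 <= rho t)%R -> measurable S -> 0 <= c ->
  (forall s, S s -> \int[mu]_(t in [set t | rho s <= rho t]%R) g t <= c) ->
  \int[mu]_(t in S) g t <= c.
Proof.
move=> mg g0 mrho rho0 mS c0 Sc.
have mtail a : measurable [set t | a <= rho t]%R.
  rewrite -[X in measurable X]setTI.
  rewrite (_ : [set t | _] = rho @^-1` `[a, +oo[%classic).
    exact: mrho.
  by apply/seteqP; split=> t /=; rewrite in_itv/= andbT.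
have [S0|/nonemptyPn ->] := pselect (S !=set0); last by rewrite integral_set0.
have hinf : has_inf (rho @` S).
  split; first by case: S0 => s Ss; exists (rho s), s.
  by exists 0%R => _ [s _ <-].
set a := inf (rho @` S).
have aS s : S s -> (a <= rho s)%R by move=> Ss; apply: ge_inf; [exact: hinf.2|exists s].
(* If rho attains its infimum a on S, one tail contains S; otherwise S lies in the
   increasing union of the sets F j, and each F j is contained in a tail. *)
have [[s Ss sa]|noatt] := pselect (exists2 s, S s & rho s = a).
  apply: le_trans (Sc s Ss); apply: ge0_subset_integral => //.
  - exact: measurable_funTS.
  - by move=> t St /=; rewrite sa aS.
pose F j := [set t | a + j.+1%:R^-1 <= rho t]%R.
have ndF : nondecreasing_seq F.
  move=> i j ij; apply/subsetPset => t; rewrite /F/=; apply: le_trans.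
  by rewrite lerD2l lef_pV2 ?posrE// ler_nat.
have SF : S `<=` \bigcup_j F j.
  move=> t St; have at_ : (a < rho t)%R.
    rewrite lt_neqAle aS// andbT; apply/eqP => e; apply: noatt; exists t => //.
  exists (Num.truncn (rho t - a)^-1) => //=.
  rewrite /F /= -lerBrDl; apply/ltW; rewrite invf_plt ?posrE ?subr_gt0//.
  exact: truncnS_gt.
have mF j : measurable (F j) by exact: mtail.
apply: (@le_trans _ _ (\int[mu]_(t in \bigcup_j F j) g t)).
  apply: ge0_subset_integral => //.
    by apply: bigcup_measurable => j _; exact: mF.
  exact: measurable_funTS.
have cvgF := ge0_nondecreasing_set_cvg_integral (mu := mu) ndF mF
  (fun i => measurable_funTS mg) (fun i t _ => g0 t).
rewrite -(cvg_lim _ cvgF)//; apply: lime_le.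
  exact: (cvgP _ cvgF).
apply: nearW => j.
have j0 : (0 < j.+1%:R^-1 :> R)%R by rewrite invr_gt0.
have [_ [s Ss <-] sj] := inf_adherent j0 hinf.
apply: le_trans (Sc s Ss); apply: ge0_subset_integral => //.
  exact: measurable_funTS.
by move=> t /=; rewrite /F/= => /(le_trans _); apply; exact: ltW.
Qed.

(** The integral is a supremum over simple functions, so that monotonicity does not depend on
   measurability; this is what makes integrals of completion-measurable functions usable. *)
Lemma ge0_le_integral_nonmeasurable (f g : T -> \bar R) :
  (forall t, 0 <= f t) -> (forall t, f t <= g t) ->
  \int[mu]_t f t <= \int[mu]_t g t.
Proof.
move=> f0 fg; rewrite !ge0_integralTE//; last first.
  by move=> t; exact: le_trans (fg t).
apply: ereal_sup_le => _ [h hf <-]; exists h => // t.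
exact: le_trans (fg t).
Qed.

Lemma ge0_integral_eq_off_null (D N : set T) (f g : T -> \bar R) :
  measurable D -> measurable N -> mu N = 0 -> measurable_fun setT g ->
  (forall t, 0 <= f t) -> (forall t, 0 <= g t) -> (forall t, ~ N t -> f t = g t) ->
  \int[mu]_(t in D) f t = \int[mu]_(t in D) g t.
Proof.
move=> mD mN N0 mg f0 g0 fg.
have mgD : measurable_fun D g by exact: measurable_funTS.
have mDN : measurable (D `\` N) by exact: measurableD.
have mNC : measurable (~` N) by exact: measurableC.
have R0 (h : T -> \bar R) A : (forall t, 0 <= h t) -> forall t, 0 <= (h \_ A) t.
  by move=> h0 t; rewrite patchE; case: ifP.
apply/eqP; rewrite eq_le; apply/andP; split; last first.
  rewrite (ge0_negligible_integral mN mD mgD (fun t _ => g0 t) N0).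
  rewrite integral_mkcond [leRHS]integral_mkcond.
  apply: ge0_le_integral_nonmeasurable; first exact: R0.
  move=> t; rewrite !patchE; case: ifPn => [/set_mem [Dt Nt]|_]; last by case: ifP.
  by rewrite mem_set// fg.
(* On the null set N nothing is known about f, so f is bounded there by +oo. *)
pose g' t := if t \in N then +oo else (g \_ D) t.
have mgr : measurable_fun setT (g \_ D) by apply/(measurable_restrictT _ _).1.
have mg' : measurable_fun setT g'.
  apply: measurable_fun_ifT => //; apply: (measurable_fun_bool true).
  rewrite setTI (_ : _ @^-1` _ = N)//.
  by apply/seteqP; split=> t /=; [exact: set_mem|exact: mem_set].
have g'0 t : 0 <= g' t by rewrite /g'; case: ifP => // _; exact: R0.
rewrite integral_mkcond; apply: (@le_trans _ _ (\int[mu]_t g' t)).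
  apply: ge0_le_integral_nonmeasurable; first exact: R0.
  move=> t; rewrite /g'; case: ifPn => [_|/negP tN]; first exact: leey.
  by rewrite !patchE fg// => Nt; apply: tN; exact: mem_set.
rewrite (ge0_negligible_integral mN measurableT mg' (fun t _ => g'0 t) N0).
rewrite [leRHS]integral_mkcond.
apply: (@le_trans _ _ (\int[mu]_(t in setT `\` N) (g \_ D) t)).
  apply: le_of_eq; apply: eq_integral => t.
  by rewrite inE => -[_ Nt]; rewrite /g' memNset.
by apply: ge0_subset_integral => //; [exact: measurableD|move=> t _; exact: R0].
Qed.

End nonnegative_integrals.

(** Off the union of countably many null sets, one for each rational q, the sublevel sets
   {V < q} are Borel; W is V there and 0 elsewhere. *)
Lemma borel_version (R : realType) n (V : 'rV[R]_n -> R) : lebesgue_measurable_fun V ->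
  exists (W : borel_rV R n -> R) (N : set (borel_rV R n)),
  [/\ measurable_fun setT W, measurable N, @lebesgue_rV R n N = 0%E &
      forall x, ~ N x -> V x = W x].
Proof.
move=> mV.
have mitv (q : rat) : completed_algebra_gen (@lebesgue_rV R n) (V @^-1` `]-oo, ratr q[%classic).
  apply: mV; exact: measurable_itv.
have /choice[F HF] (q : rat) : exists P : set (borel_rV R n) * set (borel_rV R n),
    [/\ measurable P.1, measurable P.2, @lebesgue_rV R n P.2 = 0%E &
      forall x, ~ P.2 x -> (V x < ratr q <-> P.1 x)].
  have [A mA [M [B [mB B0 MB]] E]] := mitv q.
  exists (A, B); split => //= x Bx.
  have -> : (V x < ratr q) = (V @^-1` `]-oo, ratr q[%classic) x :> Prop.
    by rewrite /preimage/= in_itv.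
  by rewrite -E; split => [[//|/MB]|]; [|left].
pose N := \bigcup_q (F q).2.
have mN : measurable N.
  by apply: countable_bigcupT_measurable => // q; have [] := HF q.
have N0 : @lebesgue_rV R n N = 0%E.
  pose G k := if unpickle k is Some q then (F q).2 else set0.
  have NG : N = \bigcup_k G k.
    apply/seteqP; split=> [x [q _ Fx]|x [k _]].
      (* Explicit term: simplification would evaluate the unary number pickle q. *)
      by refine (ex_intro2 _ _ (pickle q) I _); rewrite /G pickleK; exact: Fx.
    by rewrite /G; case: unpickle => // q Fx; exists q.
  have mG k : measurable (G k) by rewrite /G; case: unpickle => // q; have [] := HF q.
  apply/negligibleP => //; rewrite NG; apply: negligible_bigcup => k.
  apply/negligibleP => //; rewrite /G; case: unpickle => [q|]; last exact: measure0.
  by have [] := HF q.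
exists (fun x => if x \in N then 0 else V x), N; split => //; last first.
  by move=> x Nx; rewrite memNset.
apply: (@measurability _ _ _ _ _ _ _ (RGenInftyO.measurableE R)).
move=> _ [_ [a ->] <-]; rewrite setTI.
(* Off N, the condition V x < ratr q is membership in the Borel set (F q).1. *)
rewrite (_ : _ @^-1` _ = (N `&` [set x | 0 < a]) `|`
   \bigcup_(q in [set q : rat | ratr q <= a]) ((F q).1 `\` N)); last first.
  apply/seteqP; split=> x /=.
    rewrite in_itv/=; case: ifPn => [/set_mem Nx ?|]; first by left.
    rewrite notin_setE => Nx Va; right.
    have [q] := rat_in_itvoo Va; rewrite in_itv/= => /andP[q1 q2].
    exists q => /=; first exact: ltW.
    split => //; have [_ _ _ H] := HF q; apply/(H x) => //.
    by move=> Fx; apply: Nx; exists q.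
  rewrite in_itv/= => -[[Nx a0]|[q /= qa [Fx Nx]]]; first by rewrite mem_set.
  rewrite memNset//; apply: lt_le_trans qa.
  have [_ _ _ H] := HF q; apply/(H x) => //.
  by move=> Fx'; apply: Nx; exists q.
apply: measurableU.
  apply: measurableI => //; have [a0|a0] := pselect (0 < a).
    by rewrite (_ : [set _ | _] = setT)//; apply/seteqP; split.
  by rewrite (_ : [set _ | _] = set0)//; apply/seteqP; split.
rewrite bigcup_mkcond; apply: countable_bigcupT_measurable => // q.
by case: ifPn => // _; apply: measurableD => //; have [] := HF q.
Qed.

(** * Riesz kernels of the sup norm *)

Section riesz_kernel.
Context {R : realType} {n : nat}.
Local Notation E := (borel_rV R n).
Local Notation mu := (@lebesgue_rV R n).

(** Kernel of the Riesz potential of order n - e, with the sup norm. Since 0 `^ (- e) = 0 for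
   nonzero e, it vanishes on the diagonal. *)
Definition riesz (e : R) (x y : E) : R :=
  `|(x : 'rV[R]_n) - (y : 'rV[R]_n)| `^ (- e).

Lemma rieszC e x y : riesz e x y = riesz e y x.
Proof. by rewrite /riesz distrC. Qed.

Lemma riesz_ge0 e x y : 0 <= riesz e x y.
Proof. exact: powR_ge0. Qed.

Lemma rieszD e f (x y : E) : 0 < e + f ->
  riesz (e + f) x y = riesz e x y * riesz f x y.
Proof.
move=> ef; rewrite /riesz opprD powRD//.
by rewrite -opprD oppr_eq0 gt_eqF.
Qed.

Lemma measurable_riesz d (T : measurableType d) e (F G : T -> E) :
  measurable_fun setT F -> measurable_fun setT G ->
  measurable_fun setT (fun t => riesz e (F t) (G t)).
Proof.
move=> mF mG; apply: (measurableT_comp (measurable_powR (- e))).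
exact: measurable_dist.
Qed.

(** Integrability of |x - y|^-s over a union D of the annuli r h^k / 2 <= |x - y| < 2 r h^k:
   the k-th one contributes a multiple of (r h^k)^(n - s), and h^(n - s) < 1. Taking h = 1/2
   gives balls and h = 2 complements of balls. *)
Lemma radial_integral (s h : R) : 0 < s -> 0 < h -> h `^ (- s) * h ^+ n < 1 ->
  exists2 C : R, 0 < C & forall (x : 'rV[R]_n) (r : R) (D : set E),
   0 < r -> measurable D ->
   (forall y, D y -> `|x - y| != 0 ->
      exists k, r * h ^+ k / 2 <= `|x - y| < 2 * (r * h ^+ k)) ->
   (\int[mu]_(y in D) (riesz s x y)%:E <=
    (C * r `^ (n%:R - s))%:E)%E.
Proof.
move=> s0 h0 hs1.
pose q := h `^ (- s) * h ^+ n.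
have q0 : 0 < q by rewrite mulr_gt0 ?powR_gt0 ?exprn_gt0.
exists (2^-1 `^ (- s) * 4 ^+ n / (1 - q)).
  by rewrite divr_gt0 ?mulr_gt0 ?powR_gt0 ?exprn_gt0 ?subr_gt0.
move=> x r D r0 mD HD.
have rh k : 0 < r * h ^+ k by rewrite mulr_gt0 ?exprn_gt0.
rewrite [X in (_ <= X%:E)%E](_ : _ = (2^-1 `^ (- s) * 4 ^+ n * r `^ (n%:R - s)) / (1 - q)); last by rewrite mulrAC.
(* The k-th ball contains the annulus, and c k bounds the kernel there; the products
   of measure and bound form a geometric sequence of ratio q. *)
apply: (@integral_le_geometric _ _ _ _ D _ (fun k => ball x (2 * (r * h ^+ k)))
   (fun k => (r * h ^+ k / 2) `^ (- s)) (fun k => (2 * (2 * (r * h ^+ k))) ^+ n)) => //.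
- apply/measurable_EFinP; apply: measurable_funTS.
  exact: measurable_riesz.
- by move=> y _; rewrite lee_fin riesz_ge0.
- by move=> k; exact: measurable_ball_rV.
- by move=> k; rewrite powR_ge0.
- move=> k; have E := lebesgue_rV_ball x (mulr_gt0 (ltr0n R 2) (rh k)).
  by rewrite [X in (X <= _)%E]E.
- move=> y Dy fy0.
  have xy0 : `|x - y| != 0.
    apply: contra_neq fy0 => xy0; rewrite /riesz xy0 powR0// oppr_eq0 gt_eqF//.
  have [k /andP[k1 k2]] := HD y Dy xy0; exists k.
    by rewrite -ball_normE.
  rewrite lee_fin /riesz; apply: powRN_anti => //; first exact: ltW.
  by rewrite divr_gt0.
- by rewrite !mulr_ge0 ?powR_ge0 ?exprn_ge0.
- by rewrite q0 hs1.
- move=> k.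
  rewrite (_ : 2 * (2 * (r * h ^+ k)) = 4 * (r * h ^+ k)); last by ring.
  rewrite mulrC [_ / 2]mulrC [X in X `^ _]mulrA !powRM ?mulr_ge0 ?(ltW r0) ?exprn_ge0 ?(ltW h0)//.
  rewrite 2!(@exprMn R) powR_exprn ?(ltW h0)// /q exprMn.
  rewrite powRB; last by rewrite (gt_eqF r0) implybT.
  rewrite powR_mulrn ?(ltW r0)// (exprAC h k n) [r `^ (- s)]powRN.
  by apply: le_of_eq; ring.
Qed.

Lemma radial_integral_ball (s : R) : 0 < s < n%:R ->
  exists2 C : R, 0 < C & forall (x : 'rV[R]_n) (r : R), 0 < r ->
   (\int[mu]_(y in ball x r) (riesz s x y)%:E <=
    (C * r `^ (n%:R - s))%:E)%E.
Proof.
move=> /andP[s0 sn].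
have h0 : 0 < 2^-1 :> R by rewrite invr_gt0.
have hs1 : 2^-1 `^ (- s) * 2^-1 ^+ n < 1 :> R.
  rewrite -powR_mulrn ?ltW// -powRD; last by rewrite (gt_eqF h0) implybT.
  by rewrite powR_lt1 ?h0 ?invf_lt1 ?ltr1n// addrC subr_gt0.
have [C C0 HC] := radial_integral s0 h0 hs1.
exists C => // x r r0; apply: HC => //; first exact: measurable_ball_rV.
move=> y; rewrite -ball_normE /= => yr xy0.
have xy : 0 < `|x - y| by rewrite lt_def xy0 normr_ge0.
have ex : exists k, r * 2^-1 ^+ k / 2 <= `|x - y|.
  exists (Num.truncn (r / `|x - y|)).+1.
  set N := (Num.truncn _).+1.
  have h : r < N%:R * `|x - y| by rewrite -ltr_pdivrMr// truncnS_gt.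
  have hN : N%:R <= 2 ^+ N :> R by rewrite -natrX ler_nat ltnW// ltn_expl.
  have h2 : r < 2 ^+ N * `|x - y|.
    by apply: (lt_le_trans h); rewrite ler_wpM2r// ltW.
  rewrite exprVn ler_pdivrMr// ler_pdivrMr ?exprn_gt0//.
  have t0 : 0 < 2 ^+ N * `|x - y| by rewrite mulr_gt0// exprn_gt0.
  rewrite mulrAC [X in _ <= X * 2]mulrC (le_trans (ltW h2))// ler_peMr ?ler1n//.
case: (ex_minnP ex) => -[|k] hk kmin; [exists 0%N|exists k.+1].
  by rewrite hk expr0 mulr1 (lt_trans yr)// ltr_pMl// ltr1n.
rewrite hk /=; have /negP : ~ (r * 2^-1 ^+ k / 2 <= `|x - y|).
  by move=> /kmin; rewrite ltnn.
rewrite -ltNge => /lt_le_trans; apply.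
rewrite exprS (_ : 2 * _ = r * 2^-1 ^+ k); last by field.
by rewrite ler_pdivrMr// ler_peMr ?ler1n// mulr_ge0 ?(ltW r0)// exprn_ge0 ?(ltW h0).
Qed.

Lemma radial_integral_setC_ball (s : R) : n%:R < s ->
  exists2 C : R, 0 < C & forall (x : 'rV[R]_n) (r : R), 0 < r ->
   (\int[mu]_(y in ~` ball x r) (riesz s x y)%:E <=
    (C * r `^ (n%:R - s))%:E)%E.
Proof.
move=> sn; have s0 : 0 < s by exact: le_lt_trans sn.
have hs1 : 2 `^ (- s) * 2 ^+ n < 1 :> R.
  rewrite -powR_mulrn// -powRD; last by rewrite pnatr_eq0 implybT.
  rewrite -[- s + _]opprK powRN -powR_inv1 ?powR_ge0// powRAC powR_inv1//.
  apply: powR_lt1; first by rewrite invr_gt0 invf_lt1 ?ltr1n ltr0n.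
  by rewrite opprD opprK subr_gt0.
have [C C0 HC] := radial_integral s0 (ltr0n R 2) hs1.
exists C => // x r r0; apply: HC => //.
  by apply: measurableC; exact: measurable_ball_rV.
move=> y; rewrite -ball_normE /= => /negP; rewrite -leNgt => ry xy0.
have ex : exists k, `|x - y| < 2 * (r * 2 ^+ k).
  exists (Num.truncn (`|x - y| / r)).+1.
  set N := (Num.truncn _).+1.
  have h : `|x - y| < N%:R * r by rewrite -ltr_pdivrMr// truncnS_gt.
  have hN : N%:R <= 2 ^+ N :> R by rewrite -natrX ler_nat ltnW// ltn_expl.
  apply: (lt_le_trans h); rewrite mulrCA mulrC ler_wpM2l ?(ltW r0)//.
  by rewrite (le_trans hN)// ler_peMl ?ler1n// exprn_ge0.
case: (ex_minnP ex) => -[|k] hk kmin; [exists 0%N|exists k.+1].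
  by rewrite hk andbT expr0 mulr1 (le_trans _ ry)// ler_pdivrMr// ler_peMr ?ler1n// ltW.
rewrite hk andbT; have /negP : ~ (`|x - y| < 2 * (r * 2 ^+ k)).
  by move=> /kmin; rewrite ltnn.
rewrite -leNgt; apply: le_trans.
rewrite exprS mulrCA ler_pdivrMr// ler_peMr ?ler1n//.
by rewrite !mulr_ge0 ?(ltW r0)// exprn_ge0.
Qed.

(** With rho = |x - z|, the constraint gives |z - y| >= rho / 2 as well as |z - y| >= |x - y|.
   The first bound is used where |x - y| < rho and leaves an integrable singularity as
   alpha > 1; the second one is used elsewhere and decays fast enough as alpha < n. *)
Lemma kernel_composition (alpha : R) : 1 < alpha < n%:R ->
  exists2 C : R, 0 < C & forall (x z : 'rV[R]_n), x != z ->
  (\int[mu]_y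
     ((`|x - (y : 'rV[R]_n)| <= `|z - (y : 'rV[R]_n)|)%R%:R
      * riesz (n%:R + 1 - alpha) x y * riesz (n%:R - 1) z y)%:E
   <= (C * riesz (n%:R - alpha) x z)%:E)%E.
Proof.
move=> /andP[a1 an].
have s1 : 0 < n%:R + 1 - alpha < n%:R by apply/andP; split; lra.
have s2 : n%:R < n%:R + n%:R - alpha by lra.
have [C1 C10 HC1] := radial_integral_ball s1.
have [C2 C20 HC2] := radial_integral_setC_ball s2.
exists (2^-1 `^ (- (n%:R - 1)) * C1 + C2).
  by rewrite addr_gt0// mulr_gt0// powR_gt0// invr_gt0.
move=> x z xz; set rho := `|x - z|.
have rho0 : 0 < rho by rewrite normr_gt0 subr_eq0.
have mB : measurable (ball x rho : set E) by exact: measurable_ball_rV.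
have mBC : measurable (~` ball x rho : set E) by exact: measurableC.
set g := (X in (\int[_]_y (X y))%E).
have mg : measurable_fun setT g.
  apply/measurable_EFinP; apply: measurable_funM.
    apply: measurable_funM.
      by apply: measurable_fun_bool_real; apply: measurable_fun_ler; apply: measurable_dist.
    by apply: measurable_riesz.
  by apply: measurable_riesz.
have g0 y : (0 <= g y)%E by rewrite lee_fin !mulr_ge0 ?riesz_ge0// ler0n.
rewrite (ge0_integral_setC mu mB mg g0) mulrDl EFinD; apply: leeD.
- apply: (@le_trans _ _ (\int[mu]_(y in ball x rho)
    (((2^-1 * rho) `^ (- (n%:R - 1)))%:E * (riesz (n%:R + 1 - alpha) x y)%:E)))%E.
    apply: ge0_le_integral => //.
    + exact: measurable_funTS.
    + apply: measurable_funTS; apply: measurable_funeM; apply/measurable_EFinP.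
      by apply: measurable_riesz.
    + move=> y _; rewrite /g -EFinM lee_fin /riesz.
      case: (leP `|x - y| `|z - y|) => h; last by rewrite !mul0r mulr_ge0// powR_ge0.
      rewrite mul1r mulrC ler_wpM2r ?powR_ge0// powRN_anti//.
      * by lra.
      * by rewrite mulr_gt0// invr_gt0.
      * have : rho <= `|x - y| + `|y - z| by exact: ler_distD.
        by rewrite (distrC y z); lra.
  have mr : measurable_fun (ball x rho : set E) (fun y => (riesz (n%:R + 1 - alpha) x y)%:E).
    by apply: measurable_funTS; apply/measurable_EFinP; exact: measurable_riesz.
  have r0E y : (ball x rho : set E) y -> (0 <= (riesz (n%:R + 1 - alpha) x y)%:E)%E.
    by rewrite lee_fin riesz_ge0.
  have c0E : (0 <= ((2^-1 * rho) `^ (- (n%:R - 1)))%:E)%E by rewrite lee_fin powR_ge0.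
  rewrite (ge0_integralZl mu mB mr r0E c0E).
  apply: (le_trans (lee_wpmul2l _ (HC1 x rho rho0))); first by rewrite lee_fin powR_ge0.
  rewrite -EFinM lee_fin /riesz -/rho powRM ?invr_ge0 ?(ltW rho0)//.
  rewrite (_ : - (n%:R - alpha) = - (n%:R - 1) + (n%:R - (n%:R + 1 - alpha))); last by ring.
  rewrite [in leRHS]powRD; last by rewrite (gt_eqF rho0) implybT.
  by apply: le_of_eq; ring.
- apply: (@le_trans _ _ (\int[mu]_(y in ~` ball x rho)
    (riesz (n%:R + n%:R - alpha) x y)%:E))%E.
    apply: ge0_le_integral => //.
    + exact: measurable_funTS.
    + apply: measurable_funTS; apply/measurable_EFinP; exact: measurable_riesz.
    + move=> y; rewrite -ball_normE /= => /negP; rewrite -leNgt => ry.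
      have xy0 : 0 < `|x - y| by exact: lt_le_trans ry.
      rewrite /g lee_fin /riesz; case: (leP `|x - y| `|z - y|) => h; last by rewrite !mul0r powR_ge0.
      rewrite mul1r (_ : - (n%:R + n%:R - alpha) = - (n%:R + 1 - alpha) + - (n%:R - 1)); last by ring.
      rewrite powRD; last by rewrite (gt_eqF xy0) implybT.
      by rewrite ler_wpM2l ?powR_ge0// powRN_anti//; lra.
  apply: (le_trans (HC2 x rho rho0)); rewrite lee_fin.
  rewrite (_ : n%:R - (n%:R + n%:R - alpha) = - (n%:R - alpha))//; by ring.
Qed.

End riesz_kernel.

(** * Trace inequality for weights of bounded potential *)

Section trace.
Context {R : realType} {n : nat}.
Local Notation E := (borel_rV R n).
Local Notation mu := (@lebesgue_rV R n).

Lemma tonelli_rV (g : E -> E -> \bar R) :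
  measurable_fun setT (fun p : E * E => g p.1 p.2) -> (forall x y, 0 <= g x y)%E ->
  (\int[mu]_x \int[mu]_y g x y = \int[mu]_y \int[mu]_x g x y)%E.
Proof.
move=> mg g0.
exact: (fubini_tonelli (m1 := mu) (m2 := mu) (fun p => g p.1 p.2) mg (fun p => g0 p.1 p.2)).
Qed.

Lemma measurable_integral_rV d (T : measurableType d) (g : T -> E -> \bar R) :
  measurable_fun setT (fun p : T * E => g p.1 p.2) -> (forall x y, 0 <= g x y)%E ->
  measurable_fun setT (fun x => \int[mu]_y g x y)%E.
Proof.
move=> mg g0.
exact: (measurable_fun_fubini_tonelli_F (m2 := mu) (fun p => g p.1 p.2) mg (fun p => g0 p.1 p.2)).
Qed.

(** The part of the potential of order 1 of g at y that comes from the points no closer to y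
   than x. *)
Definition outer_potential (g : E -> R) (y x : E) : \bar R :=
  (\int[mu]_z ((`|(y : 'rV[R]_n) - (x : 'rV[R]_n)| <=
                `|(y : 'rV[R]_n) - (z : 'rV[R]_n)|)%R%:R
               * (riesz (n%:R - 1) y z * g z))%:E)%E.

Lemma measurable_outer_integrand (g : E -> R) : measurable_fun setT g ->
  measurable_fun setT (fun p : (E * E) * E =>
    ((`|(p.1.1 : 'rV[R]_n) - (p.1.2 : 'rV[R]_n)| <=
       `|(p.1.1 : 'rV[R]_n) - (p.2 : 'rV[R]_n)|)%R%:R
       * (riesz (n%:R - 1) p.1.1 p.2 * g p.2))%:E).
Proof.
move=> mg.
have m1 : measurable_fun setT (fun p : (E * E) * E => p.1.1).
  exact: measurableT_comp measurable_fst measurable_fst.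
have m2 : measurable_fun setT (fun p : (E * E) * E => p.1.2).
  exact: measurableT_comp measurable_snd measurable_fst.
apply/measurable_EFinP; apply: measurable_funM.
  by apply: measurable_fun_bool_real; apply: measurable_fun_ler; exact: measurable_dist.
apply: measurable_funM; first exact: measurable_riesz.
exact: (measurableT_comp mg measurable_snd).
Qed.

Lemma measurable_outer_potential (g : E -> R) : measurable_fun setT g ->
  (forall x, 0 <= g x) ->
  measurable_fun setT (fun p : E * E => outer_potential g p.1 p.2).
Proof.
move=> mg g0.
apply: (measurable_fun_fubini_tonelli_F (m2 := mu) _ (measurable_outer_integrand mg)).
by move=> p; rewrite lee_fin !mulr_ge0 ?riesz_ge0 ?ler0n.
Qed.

Lemma outer_potential_ge0 (g : E -> R) y x : (forall x, 0 <= g x) ->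
  (0 <= outer_potential g y x)%E.
Proof.
by move=> g0; apply: integral_ge0 => z _; rewrite lee_fin !mulr_ge0 ?riesz_ge0 ?ler0n.
Qed.

Section fixed_centre.
Variables (alpha A L : R) (w u : E -> R) (y : E).
Hypotheses (alpha12 : 1 < alpha <= 2) (A0 : 0 < A) (L0 : 0 < L).
Hypotheses (mw : measurable_fun setT w) (meas_u : measurable_fun setT u).
Hypotheses (w0 : forall x, 0 <= w x) (u0 : forall x, 0 <= u x).
Hypothesis wA : (\int[mu]_z (riesz (n%:R - alpha) y z * w z)%:E <= A%:E)%E.

Let mub (b : R) : measurable_fun setT (fun x => u x `^ b).
Proof. exact: (measurableT_comp (measurable_powR b) meas_u). Qed.

(** The weight (u z) `^ (alpha - 1) is controlled by u z and a constant, by concavity. The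
   constant term only meets distances at least r, where the kernel of order 1 is at most
   r^(1 - alpha) times the kernel of order alpha, whose integral against w is at most A. *)
Lemma tail_interpolation (r : R) : 0 < r ->
  (\int[mu]_(z in [set z : E | (r <= `|(y : 'rV[R]_n) - (z : 'rV[R]_n)|)%R])
     (riesz (n%:R - 1) y z * (u z * w z))%:E <= (L * r `^ (2 - alpha))%:E)%E ->
  (\int[mu]_(z in [set z : E | (r <= `|(y : 'rV[R]_n) - (z : 'rV[R]_n)|)%R])
     (riesz (n%:R - 1) y z * (u z `^ (alpha - 1) * w z))%:E <=
     (2 * (L `^ (alpha - 1) * A `^ (2 - alpha)))%:E)%E.
Proof.
move: (alpha12) => /andP[a1 a2] r0 HL; set D := [set z : E | _].
have mD : measurable D.
  rewrite -[X in measurable X]setTI.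
  rewrite (_ : D = (fun z : E => `|(y : 'rV[R]_n) - (z : 'rV[R]_n)|) @^-1` `[r, +oo[%classic).
    exact: measurable_dist.
  by apply/seteqP; split=> t; rewrite /D/= in_itv/= andbT.
pose b := alpha - 1; have b01 : 0 < b <= 1 by rewrite /b; apply/andP; split; lra.
have /andP[b0 b1] := b01.
(* At this value of t both terms of the interpolation are at most half of the bound. *)
pose t := L * r / A.
have t0 : 0 < t by rewrite divr_gt0// mulr_gt0.
pose g1 (z : E) : R := riesz (n%:R - 1) y z * (u z * w z).
pose g2 (z : E) : R := riesz (n%:R - alpha) y z * w z.
have mg1 : measurable_fun setT g1.
  apply: measurable_funM; first exact: measurable_riesz.
  exact: measurable_funM.
have mg2 : measurable_fun setT g2.
  by apply: measurable_funM => //; exact: measurable_riesz.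
have g10 z : 0 <= g1 z by rewrite !mulr_ge0// riesz_ge0.
have g20 z : 0 <= g2 z by rewrite mulr_ge0// riesz_ge0.
have tb0 : 0 <= t `^ (b - 1) by exact: powR_ge0.
have tr0 : 0 <= t `^ b * r `^ (- b) by rewrite mulr_ge0// powR_ge0.
apply: (@le_trans _ _ (\int[mu]_(z in D) (t `^ (b - 1) * g1 z +
   (t `^ b * r `^ (- b)) * g2 z)%:E))%E.
  apply: ge0_le_integral => //.
  - by move=> z _; rewrite lee_fin !mulr_ge0 ?powR_ge0.
  - apply/measurable_EFinP/measurable_funTS; apply: measurable_funM; first exact: measurable_riesz.
    exact: measurable_funM.
  - apply/measurable_EFinP/measurable_funTS; apply: measurable_funD; exact: measurable_funM.
  - move=> z Dz; rewrite lee_fin.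
    have yz0 : 0 < `|(y : 'rV[R]_n) - (z : 'rV[R]_n)| by exact: lt_le_trans Dz.
    have E1 : riesz (n%:R - 1) y z = riesz (n%:R - alpha) y z * riesz b y z.
      rewrite /riesz -powRD; last by rewrite (gt_eqF yz0) implybT.
      by congr powR; rewrite /b; ring.
    have le1 : riesz b y z <= r `^ (- b) by apply: powRN_anti => //; exact: ltW.
    have Hc := powR_concave_le (u0 z) t0 b01.
    have k0 := riesz_ge0 (n%:R - 1) y z.
    apply: (@le_trans _ _ (riesz (n%:R - 1) y z * ((t `^ (b - 1) * u z + t `^ b) * w z))).
      by rewrite ler_wpM2l// ler_wpM2r.
    rewrite mulrDl mulrDr lerD//; first by rewrite /g1; apply: le_of_eq; ring.
    rewrite E1 (_ : _ * _ * _ = riesz b y z * (t `^ b * g2 z)); last by rewrite /g2; ring.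
    rewrite (_ : t `^ b * _ * _ = r `^ (- b) * (t `^ b * g2 z)); last by ring.
    by rewrite ler_wpM2r// mulr_ge0// powR_ge0.
have sub (g : E -> R) : measurable_fun setT g -> (forall z, 0 <= g z) ->
    (\int[mu]_(z in D) (g z)%:E <= \int[mu]_z (g z)%:E)%E.
  move=> mg g0; apply: ge0_subset_integral => //.
    exact/measurable_EFinP.
  by move=> z _; rewrite lee_fin.
rewrite ge0_integral_lin// mulrDl mul1r EFinD; apply: leeD.
- apply: (le_trans (lee_wpmul2l _ HL)); first by rewrite lee_fin.
  rewrite -EFinM lee_fin /t -mulrA powRM ?(ltW L0)//; last by rewrite mulr_ge0 ?invr_ge0 ?ltW.
  rewrite powRM ?invr_ge0 ?(ltW A0) ?(ltW r0)//.
  rewrite -[in A^-1 `^ _]powR_inv1 ?(ltW A0)// -powRrM mulN1r.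
  rewrite (_ : - (b - 1) = 2 - alpha); last by rewrite /b; ring.
  rewrite (_ : 2 - alpha = - (b - 1)); last by rewrite /b; ring.
  rewrite [r `^ (- _)]powRN -/b.
  rewrite [L `^ (b - 1)]powRD; last by rewrite (gt_eqF L0) implybT.
  rewrite powR_inv1 ?(ltW L0)//.
  have rn0 : r `^ (b - 1) != 0 by rewrite gt_eqF// powR_gt0.
  have Ln0 : L != 0 by rewrite gt_eqF.
  apply: le_of_eq.
  by field; rewrite rn0 Ln0.
- have g2A : (\int[mu]_(z in D) (g2 z)%:E <= A%:E)%E by exact: le_trans (sub _ mg2 g20) wA.
  apply: (le_trans (lee_wpmul2l _ g2A)); first by rewrite lee_fin.
  rewrite -EFinM lee_fin /t -mulrA powRM ?(ltW L0)//; last by rewrite mulr_ge0 ?invr_ge0 ?ltW.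
  rewrite powRM ?invr_ge0 ?(ltW A0) ?(ltW r0)//.
  rewrite -[in A^-1 `^ _]powR_inv1 ?(ltW A0)// -powRrM mulN1r.
  rewrite -/b [r `^ (- _)]powRN (_ : 2 - alpha = - b + 1); last by rewrite /b; ring.
  rewrite [A `^ (- b + 1)]powRD; last by rewrite (gt_eqF A0) implybT.
  rewrite powRr1 ?(ltW A0)//.
  have rn0 : r `^ b != 0 by rewrite gt_eqF// powR_gt0.
  apply: le_of_eq.
  by field.
Qed.

End fixed_centre.

Section threshold.
Variables (alpha A : R) (w u : E -> R) (y : E).
Hypotheses (n1 : 1 < n%:R :> R) (alpha12 : 1 < alpha <= 2) (A0 : 0 < A).
Hypotheses (mw : measurable_fun setT w) (meas_u : measurable_fun setT u).
Hypotheses (w0 : forall x, 0 <= w x) (u0 : forall x, 0 <= u x).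
Hypothesis wA : (\int[mu]_z (riesz (n%:R - alpha) y z * w z)%:E <= A%:E)%E.

Let mub (b : R) : measurable_fun setT (fun x => u x `^ b).
Proof. exact: (measurableT_comp (measurable_powR b) meas_u). Qed.

(** In the intended use phi = |grad u (y)|. Let S be the set where the outer potential of u w,
   weighted by |x - y|^(alpha - 2), is below lam * phi. On S the estimate
   [tail_interpolation] applies to each tail and gives the first term. Off S, phi itself is at
   most lam^-1 times the weighted outer potential, which gives the second term. *)
Lemma threshold_split (phi lam : R) : 0 < phi -> 0 < lam ->
  (phi%:E * \int[mu]_x (riesz (n%:R - 1) y x * (u x `^ (alpha - 1) * w x))%:E <=
   (2 * (lam `^ (alpha - 1) * A `^ (2 - alpha)) * phi `^ alpha)%:E +
   lam^-1%:E * \int[mu]_x ((riesz (n%:R - 1) y x * (u x `^ (alpha - 1) * w x)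
       * riesz (2 - alpha) y x)%:E * outer_potential (fun z => u z * w z)%R y x))%E.
Proof.
move=> phi0 lam0; move: (alpha12) => /andP[a1 a2].
have L0 : 0 < lam * phi by rewrite mulr_gt0.
have muw : measurable_fun setT (fun z => u z * w z) by exact: measurable_funM.
have uw0 z : 0 <= u z * w z by rewrite mulr_ge0.
pose g (x : E) := riesz (n%:R - 1) y x * (u x `^ (alpha - 1) * w x).
have mg : measurable_fun setT g.
  apply: measurable_funM; first exact: measurable_riesz.
  exact: measurable_funM.
have g0 x : 0 <= g x by rewrite !mulr_ge0 ?riesz_ge0 ?powR_ge0.
pose U x := outer_potential (fun z => u z * w z) y x.
have mU : measurable_fun setT U.
  exact: (measurableT_comp (measurable_outer_potential muw uw0) (pair1_measurable y)).
have U0 x : (0 <= U x)%E by exact: outer_potential_ge0.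
have mdist : measurable_fun setT (fun x : E => `|(y : 'rV[R]_n) - (x : 'rV[R]_n)|).
  exact: measurable_dist.
have mrU : measurable_fun setT (fun x => (riesz (2 - alpha) y x)%:E * U x)%E.
  by apply: emeasurable_funM => //; apply/measurable_EFinP; exact: measurable_riesz.
(* Points at distance 0 from y are kept out of S; the kernel vanishes there by convention. *)
pose S := [set x : E | (0 < `|(y : 'rV[R]_n) - (x : 'rV[R]_n)|)%R] `&`
          [set x : E | ((riesz (2 - alpha) y x)%:E * U x < (lam * phi)%:E)%E].
have mS : measurable S.
  apply: measurableI.
    rewrite -[X in measurable X]setTI (_ : [set x : E | _] =
      (fun x : E => `|(y : 'rV[R]_n) - (x : 'rV[R]_n)|) @^-1` `]0, +oo[%classic); first exact: mdist.
    by apply/seteqP; split=> t /=; rewrite in_itv/= andbT.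
  rewrite -[X in measurable X]setTI.
  exact: emeasurable_fun_infty_o.
have mgE : measurable_fun setT (EFin \o g) by exact/measurable_EFinP.
have g0E x : (0 <= (EFin \o g) x)%E by rewrite lee_fin.
have intS : (\int[mu]_(x in S) (g x)%:E <=
    (2 * ((lam * phi) `^ (alpha - 1) * A `^ (2 - alpha)))%:E)%E.
  apply: (integral_le_of_tails mgE g0E mdist) => //.
    by rewrite lee_fin !mulr_ge0 ?powR_ge0.
  move=> s [s0 Us]; apply: (tail_interpolation alpha12 A0 L0) => //.
  rewrite integral_bool_restrict.
  move: Us; rewrite /= /riesz powRN => /ltW.
  by rewrite lee_pdivrMl ?powR_gt0// -EFinM mulrC.
have mSC : measurable (~` S) by exact: measurableC.
have phi0E : (0 <= phi%:E)%E by rewrite lee_fin ltW.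
have lami0 : 0 <= lam^-1 by rewrite invr_ge0 ltW.
rewrite (ge0_integral_setC mu mS mgE g0E) ge0_muleDr; [|exact: integral_ge0..].
apply: leeD.
  apply: (le_trans (lee_wpmul2l phi0E intS)).
  rewrite -EFinM lee_fin powRM ?(ltW lam0) ?(ltW phi0)//.
  rewrite -(mulr_powRB1 (ltW phi0) (_ : 0 < alpha)); last by lra.
  by apply: le_of_eq; ring.
pose G x := ((g x * riesz (2 - alpha) y x)%:E * U x)%E.
have mG : measurable_fun setT G.
  apply: emeasurable_funM => //; apply/measurable_EFinP; apply: measurable_funM => //.
  exact: measurable_riesz.
have G0 x : (0 <= G x)%E by rewrite mule_ge0// lee_fin mulr_ge0// riesz_ge0.
rewrite -(ge0_integralZl mu mSC (measurable_funTS mgE) (fun x _ => g0E x) phi0E).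
rewrite -(ge0_integralTZl mu lami0 mG G0).
apply: (@le_trans _ _ (\int[mu]_(x in ~` S) (lam^-1%:E * G x))%E).
  apply: ge0_le_integral => //.
  - by move=> x _; rewrite mule_ge0.
  - by apply: measurable_funTS; exact: measurable_funeM.
  - by apply: measurable_funTS; exact: measurable_funeM.
  move=> x Sx /=; have [xy0|xy0] := eqVneq `|(y : 'rV[R]_n) - (x : 'rV[R]_n)| 0.
    have -> : g x = 0 by rewrite /g /riesz xy0 powR0 ?mul0r// oppr_eq0 subr_eq0 gt_eqF.
    by rewrite mule0 mule_ge0// lee_fin.
  have Ux : ((lam * phi)%:E <= (riesz (2 - alpha) y x)%:E * U x)%E.
    rewrite leNgt; apply/negP => h; apply: Sx; split => //=.
    by rewrite lt_def xy0 normr_ge0.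
  have -> : G x = ((g x)%:E * ((riesz (2 - alpha) y x)%:E * U x))%E.
    by rewrite /G EFinM muleA.
  rewrite muleCA [leLHS]muleC.
  apply: lee_wpmul2l; first by rewrite lee_fin.
  by rewrite lee_pdivlMl// -EFinM.
apply: ge0_subset_integral => //; first exact: measurable_funeM.
by move=> x _; rewrite mule_ge0.
Qed.

End threshold.

Section interaction.
Variables (alpha A C : R) (w u : E -> R).
Hypotheses (n1 : 1 < n%:R :> R) (alpha12 : 1 < alpha <= 2).
Hypotheses (A0 : 0 < A) (C0 : 0 < C).
Hypotheses (mw : measurable_fun setT w) (meas_u : measurable_fun setT u).
Hypotheses (w0 : forall x, 0 <= w x) (u0 : forall x, 0 <= u x).
Hypothesis wA : forall x,
  (\int[mu]_z (riesz (n%:R - alpha) x z * w z)%:E <= A%:E)%E.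
Hypothesis kC : forall (x z : 'rV[R]_n), x != z ->
  (\int[mu]_y
     ((`|x - (y : 'rV[R]_n)| <= `|z - (y : 'rV[R]_n)|)%R%:R
      * riesz (n%:R + 1 - alpha) x y * riesz (n%:R - 1) z y)%:E
   <= (C * riesz (n%:R - alpha) x z)%:E)%E.

Let mub (b : R) : measurable_fun setT (fun x => u x `^ b).
Proof. exact: (measurableT_comp (measurable_powR b) meas_u). Qed.

Let X := (\int[mu]_x (w x * u x `^ alpha)%:E)%E.
Let P (x z : E) : R := C * (w x * u x `^ alpha) * (riesz (n%:R - alpha) x z * w z).

Let P0 x z : 0 <= P x z.
Proof. by rewrite !mulr_ge0 ?riesz_ge0 ?powR_ge0// ltW. Qed.

Let mP : measurable_fun setT (fun p : E * E => (P p.1 p.2)%:E).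
Proof.
apply/measurable_EFinP; apply: measurable_funM.
  apply: measurable_funM => //; apply: measurable_funM.
    exact: (measurableT_comp mw measurable_fst).
  exact: (measurableT_comp (mub alpha) measurable_fst).
apply: measurable_funM; first exact: measurable_riesz.
exact: (measurableT_comp mw measurable_snd).
Qed.

Let mX : measurable_fun setT (fun x => (w x * u x `^ alpha)%:E).
Proof. by apply/measurable_EFinP; exact: measurable_funM. Qed.

Let X0 x : (0 <= (w x * u x `^ alpha)%:E)%E.
Proof. by rewrite lee_fin mulr_ge0 ?powR_ge0. Qed.

Let potential_energy : (\int[mu]_x \int[mu]_z (P x z)%:E <= (C * A)%:E * X)%E.
Proof.
have CA0 : 0 <= C * A by rewrite mulr_ge0// ltW.
rewrite /X -(ge0_integralTZl mu CA0 mX X0).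
apply: ge0_le_integralT.
- by apply: (measurable_integral_rV (g := fun x z => (P x z)%:E)) => // x z; rewrite lee_fin.
- exact: measurable_funeM.
- by move=> x; apply: integral_ge0 => z _; rewrite lee_fin.
move=> x; have c0 : 0 <= C * (w x * u x `^ alpha).
  by rewrite !mulr_ge0 ?powR_ge0// ltW.
under eq_integral do rewrite EFinM.
rewrite (ge0_integralTZl mu c0); last 2 first.
- apply/measurable_EFinP; apply: measurable_funM => //; exact: measurable_riesz.
- by move=> z; rewrite lee_fin mulr_ge0 ?riesz_ge0.
apply: (le_trans (lee_wpmul2l _ (wA x))); first by rewrite lee_fin.
by rewrite -!EFinM lee_fin; apply: le_of_eq; ring.
Qed.

Let J (y x z : E) : R := (riesz (n%:R - 1) y x * (u x `^ (alpha - 1) * w x)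
   * riesz (2 - alpha) y x) *
  ((`|(y : 'rV[R]_n) - (x : 'rV[R]_n)| <=
                `|(y : 'rV[R]_n) - (z : 'rV[R]_n)|)%R%:R
               * (riesz (n%:R - 1) y z * (u z * w z))).

Let J0 y x z : 0 <= J y x z.
Proof. by rewrite !mulr_ge0 ?riesz_ge0 ?powR_ge0 ?ler0n. Qed.

Let mJ d (T : measurableType d) (F G H : T -> E) : measurable_fun setT F ->
  measurable_fun setT G -> measurable_fun setT H ->
  measurable_fun setT (fun t => (J (F t) (G t) (H t))%:E).
Proof.
move=> mF mG mH; apply/measurable_EFinP; apply: measurable_funM.
  apply: measurable_funM; last exact: measurable_riesz.
  apply: measurable_funM; first exact: measurable_riesz.
  apply: measurable_funM; first exact: (measurableT_comp (mub _) mG).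
  exact: (measurableT_comp mw mG).
apply: measurable_funM.
  by apply: measurable_fun_bool_real; apply: measurable_fun_ler; exact: measurable_dist.
apply: measurable_funM; first exact: measurable_riesz.
apply: measurable_funM; first exact: (measurableT_comp meas_u mH).
exact: (measurableT_comp mw mH).
Qed.

Let young (a b : R) : 0 <= a -> 0 <= b -> a `^ (alpha - 1) * b <= a `^ alpha + b `^ alpha.
Proof.
move=> a0 b0; move: (alpha12) => /andP[a1 a2].
have al0 : 0 < alpha by lra.
have [ab|ba] := leP a b.
  rewrite -[leLHS]add0r lerD ?powR_ge0// -(mulr_powRB1 b0 al0) mulrC ler_wpM2l//.
  by apply: ge0_ler_powR; rewrite ?nnegrE//; lra.
rewrite -[leLHS]addr0 lerD ?powR_ge0// -(mulr_powRB1 a0 al0) mulrC ler_wpM2r ?powR_ge0//.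
exact: ltW.
Qed.

Let composed (x z : E) : x != z -> (\int[mu]_y (J y x z)%:E <= (P x z + P z x)%:E)%E.
Proof.
move=> xz; move: (alpha12) => /andP[a1 a2].
set c := u x `^ (alpha - 1) * w x * (u z * w z).
have c0 : 0 <= c by rewrite !mulr_ge0 ?powR_ge0.
pose K y := (`|(x : 'rV[R]_n) - (y : 'rV[R]_n)| <= `|(z : 'rV[R]_n) - (y : 'rV[R]_n)|)%R%:R
      * riesz (n%:R + 1 - alpha) x y * riesz (n%:R - 1) z y.
have JK y : J y x z = c * K y.
  have Er : riesz (n%:R - 1) y x * riesz (2 - alpha) y x = riesz (n%:R + 1 - alpha) x y.
    rewrite -rieszD; last by rewrite ltr_wpDr ?subr_ge0 ?subr_gt0.
    by rewrite rieszC; congr riesz; ring.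
  rewrite /J /K /c -Er (rieszC _ z y).
  by rewrite [`|(x : 'rV[R]_n) - _|]distrC [`|(z : 'rV[R]_n) - _|]distrC; ring.
under eq_integral do rewrite JK EFinM.
rewrite (ge0_integralTZl mu c0); last 2 first.
- apply/measurable_EFinP; apply: measurable_funM.
    apply: measurable_funM.
      by apply: measurable_fun_bool_real; apply: measurable_fun_ler; exact: measurable_dist.
    exact: measurable_riesz.
  exact: measurable_riesz.
- by move=> y; rewrite lee_fin !mulr_ge0 ?riesz_ge0 ?ler0n.
apply: (le_trans (lee_wpmul2l _ (kC xz))); first by rewrite lee_fin.
rewrite -EFinM lee_fin /P (rieszC _ z x).
apply: (@le_trans _ _ (C * riesz (n%:R - alpha) x z * (w x * w z) *
  (u x `^ (alpha - 1) * u z))).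
  by rewrite /c; apply: le_of_eq; ring.
apply: (le_trans (ler_wpM2l _ (young (u0 x) (u0 z)))).
  by rewrite !mulr_ge0 ?riesz_ge0// ltW.
by apply: le_of_eq; ring.
Qed.

(** Integrating the triple integral in y first replaces the product of the three kernels by the
   kernel of order alpha between x and z; it remains to apply Young's inequality to
   (u x) `^ (alpha - 1) * u z, and then the bound A on the potential of w. *)
Lemma interaction_bound :
  (\int[mu]_y \int[mu]_x ((riesz (n%:R - 1) y x * (u x `^ (alpha - 1) * w x)
       * riesz (2 - alpha) y x)%:E * outer_potential (fun z => u z * w z)%R y x)
   <= (2 * (C * A))%:E * \int[mu]_x (w x * u x `^ alpha)%:E)%E.
Proof.
rewrite -/X.
have muw : measurable_fun setT (fun z => u z * w z) by exact: measurable_funM.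
have uw0 z : 0 <= u z * w z by rewrite mulr_ge0.
have m11 : measurable_fun setT (fun p : (E * E) * E => p.1.1).
  exact: measurableT_comp measurable_fst measurable_fst.
have m12 : measurable_fun setT (fun p : (E * E) * E => p.1.2).
  exact: measurableT_comp measurable_snd measurable_fst.
have mJyx : measurable_fun setT (fun p : E * E => \int[mu]_z (J p.1 p.2 z)%:E)%E.
  apply: (measurable_integral_rV (g := fun (p : E * E) z => (J p.1 p.2 z)%:E)).
    exact: mJ.
  by move=> p z; rewrite lee_fin.
have -> : (\int[mu]_y \int[mu]_x ((riesz (n%:R - 1) y x * (u x `^ (alpha - 1) * w x)
       * riesz (2 - alpha) y x)%:E * outer_potential (fun z => u z * w z)%R y x)
   = \int[mu]_y \int[mu]_x \int[mu]_z (J y x z)%:E)%E.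
  apply: eq_integral => y _; apply: eq_integral => x _.
  rewrite /outer_potential -ge0_integralTZl.
  - by apply: eq_integral => z _; rewrite -EFinM.
  - by rewrite !mulr_ge0 ?riesz_ge0 ?powR_ge0.
  - exact: (measurableT_comp (measurable_outer_integrand muw) (pair1_measurable (y, x))).
  - by move=> z; rewrite lee_fin !mulr_ge0 ?riesz_ge0 ?ler0n.
rewrite (tonelli_rV (g := fun y x => \int[mu]_z (J y x z)%:E)%E)//; last first.
  by move=> y x; apply: integral_ge0 => z _; rewrite lee_fin.
apply: (@le_trans _ _ (\int[mu]_x (\int[mu]_z (P x z)%:E + \int[mu]_z (P z x)%:E))%E).
  have mP1 : measurable_fun setT (fun x => \int[mu]_z (P x z)%:E)%E.
    by apply: (measurable_integral_rV (g := fun x z => (P x z)%:E)) => // x z; rewrite lee_fin.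
  have mPs : measurable_fun setT (fun p : E * E => (P p.2 p.1)%:E).
    exact: (measurableT_comp mP (@measurable_swap _ _ E E)).
  have mP2 : measurable_fun setT (fun x => \int[mu]_z (P z x)%:E)%E.
    by apply: (measurable_integral_rV (g := fun x z => (P z x)%:E)) => // x z; rewrite lee_fin.
  apply: ge0_le_integralT.
  - apply: (measurable_integral_rV (g := fun x y => \int[mu]_z (J y x z)%:E)%E).
      exact: (measurableT_comp mJyx (@measurable_swap _ _ E E)).
    by move=> x y; apply: integral_ge0 => z _; rewrite lee_fin.
  - exact: emeasurable_funD.
  - by move=> x; do 2 (apply: integral_ge0 => ? _); rewrite lee_fin.
  move=> x.
  rewrite (tonelli_rV (g := fun y z => (J y x z)%:E)); last 2 first.
  - apply: mJ => //; exact: measurable_cst.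
  - by move=> y z; rewrite lee_fin.
  have mPx : measurable_fun setT (fun z => (P x z)%:E).
    exact: (measurableT_comp mP (pair1_measurable x)).
  have mPx' : measurable_fun setT (fun z => (P z x)%:E).
    exact: (measurableT_comp mPs (pair1_measurable x)).
  have mx := measurable_set1_rV x.
  have n0 : (0 < n)%N by rewrite -(ltr_nat R); apply: lt_trans n1.
  have mJz : measurable_fun setT (fun z => \int[mu]_y (J y x z)%:E)%E.
    apply: (measurable_integral_rV (g := fun z y => (J y x z)%:E)).
      apply: mJ => //; exact: measurable_cst.
    by move=> z y; rewrite lee_fin.
  have Jz0 z : (0 <= \int[mu]_y (J y x z)%:E)%E by apply: integral_ge0 => y _; rewrite lee_fin.
  have mPP : measurable_fun setT (fun z => (P x z + P z x)%:E).
    rewrite [X in measurable_fun _ X](_ : _ = (fun z => (P x z)%:E + (P z x)%:E)%E)//.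
    exact: emeasurable_funD.
  (* At z = x the composed kernel diverges while riesz vanishes by convention; a point
     is a null set. *)
  rewrite (ge0_negligible_integral mx measurableT mJz (fun z _ => Jz0 z) (lebesgue_rV_set1 x n0)).
  have mTx : measurable ([set: E] `\` [set x]) by exact: measurableD.
  apply: (@le_trans _ _ (\int[mu]_(z in [set: E] `\` [set x]) (P x z + P z x)%:E)%E).
    apply: ge0_le_integral => //; [exact: measurable_funTS..|].
    by move=> z [_ /= xz]; apply: composed; apply/eqP => xz'; apply: xz.
  apply: (@le_trans _ _ (\int[mu]_z (P x z + P z x)%:E)%E).
    apply: ge0_subset_integral => //.
    by move=> z _; rewrite lee_fin addr_ge0.
  under eq_integral do rewrite EFinD.
  have p1 (z : E) : [set: E] z -> (0 <= (P x z)%:E)%E by rewrite lee_fin.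
  have p2 (z : E) : [set: E] z -> (0 <= (P z x)%:E)%E by rewrite lee_fin.
  by rewrite (ge0_integralD mu measurableT p1 mPx p2 mPx').
have mP1 : measurable_fun setT (fun x => \int[mu]_z (P x z)%:E)%E.
  by apply: (measurable_integral_rV (g := fun x z => (P x z)%:E)) => // x z; rewrite lee_fin.
have mPs : measurable_fun setT (fun p : E * E => (P p.2 p.1)%:E).
  exact: (measurableT_comp mP (@measurable_swap _ _ E E)).
have mP2 : measurable_fun setT (fun x => \int[mu]_z (P z x)%:E)%E.
  by apply: (measurable_integral_rV (g := fun x z => (P z x)%:E)) => // x z; rewrite lee_fin.
rewrite ge0_integralD//; [|by move=> x _; apply: integral_ge0 => z _; rewrite lee_fin..].
rewrite (tonelli_rV (g := fun x z => (P z x)%:E))//; last by move=> x z; rewrite lee_fin.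
rewrite mulr_natl mulr2n EFinD ge0_muleDl ?lee_fin ?mulr_ge0 ?(ltW A0) ?(ltW C0)//.
by apply: leeD; exact: potential_energy.
Qed.

End interaction.

Section duality.
Variables (alpha C0 : R) (w u f : E -> R).
Hypothesis C00 : 0 < C0.
Hypotheses (mw : measurable_fun setT w) (meas_u : measurable_fun setT u).
Hypothesis mf : measurable_fun setT f.
Hypotheses (w0 : forall x, 0 <= w x) (u0 : forall x, 0 <= u x).
Hypothesis f0 : forall x, 0 <= f x.
Hypothesis uf : forall x,
  ((u x)%:E <= C0%:E * \int[mu]_y (f y * riesz (n%:R - 1) x y)%:E)%E.

Let mub (b : R) : measurable_fun setT (fun x => u x `^ b).
Proof. exact: (measurableT_comp (measurable_powR b) meas_u). Qed.

Let g (y x : E) := riesz (n%:R - 1) y x * (u x `^ (alpha - 1) * w x).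

Let g0 y x : 0 <= g y x.
Proof. by rewrite !mulr_ge0 ?riesz_ge0 ?powR_ge0. Qed.

Let mg : measurable_fun setT (fun p : E * E => g p.1 p.2).
Proof.
apply: measurable_funM; first exact: measurable_riesz.
apply: measurable_funM; first exact: (measurableT_comp (mub _) measurable_snd).
exact: (measurableT_comp mw measurable_snd).
Qed.

Let mgE : measurable_fun setT (fun p : E * E => (g p.1 p.2)%:E).
Proof. exact/measurable_EFinP. Qed.

Let mgy y : measurable_fun setT (fun x : E => (g y x)%:E).
Proof. exact: (measurableT_comp mgE (pair1_measurable y)). Qed.

Let G0 y : (0 <= \int[mu]_x (g y x)%:E)%E.
Proof. by apply: integral_ge0 => x _; rewrite lee_fin. Qed.

Let mG : measurable_fun setT (fun y : E => \int[mu]_x (g y x)%:E)%E.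
Proof. by apply: (measurable_integral_rV (g := fun y x => (g y x)%:E)) => // y x; rewrite lee_fin. Qed.

(** Write (u x) `^ alpha as (u x) `^ (alpha - 1) * u x, insert the representation in the last
   factor and exchange the integrals. *)
Lemma duality_bound : 0 < alpha ->
  (\int[mu]_x (w x * u x `^ alpha)%:E <=
   C0%:E * \int[mu]_y ((f y)%:E * \int[mu]_x (g y x)%:E))%E.
Proof.
move=> al0.
have mfg : measurable_fun setT (fun p : E * E => (f p.2 * g p.2 p.1)%:E).
  apply/measurable_EFinP; apply: measurable_funM.
    exact: (measurableT_comp mf measurable_snd).
  exact: (measurableT_comp mg (@measurable_swap _ _ E E)).
have fg0 x y : (0 <= (f y * g y x)%:E)%E by rewrite lee_fin mulr_ge0.
have mfgx x : measurable_fun setT (fun y : E => (f y * g y x)%:E).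
  exact: (measurableT_comp mfg (pair1_measurable x)).
have C0E : 0 <= C0 by exact: ltW.
have -> : (\int[mu]_y ((f y)%:E * \int[mu]_x (g y x)%:E) =
    \int[mu]_y \int[mu]_x (f y * g y x)%:E)%E.
  apply: eq_integral => y _; rewrite -(ge0_integralTZl mu (f0 y) (mgy y)).
    by apply: eq_integral => x _; rewrite EFinM.
  by move=> x; rewrite lee_fin.
rewrite -(tonelli_rV (g := fun x y => (f y * g y x)%:E))//.
have mFx : measurable_fun setT (fun x : E => \int[mu]_y (f y * g y x)%:E)%E.
  exact: (measurable_integral_rV (g := fun x y => (f y * g y x)%:E)).
have Fx0 x : (0 <= \int[mu]_y (f y * g y x)%:E)%E by exact: integral_ge0.
rewrite -(ge0_integralTZl mu C0E mFx Fx0).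
apply: ge0_le_integralT => //.
- by apply/measurable_EFinP; exact: measurable_funM.
- exact: measurable_funeM.
- by move=> x; rewrite lee_fin mulr_ge0 ?powR_ge0.
move=> x; set c := u x `^ (alpha - 1) * w x.
have c0 : 0 <= c by rewrite mulr_ge0 ?powR_ge0.
have -> : w x * u x `^ alpha = c * u x.
  by rewrite /c -(mulr_powRB1 (u0 x) al0); ring.
have mfr : measurable_fun setT (fun y => (f y * riesz (n%:R - 1) x y)%:E).
  by apply/measurable_EFinP; apply: measurable_funM => //; exact: measurable_riesz.
have -> : (\int[mu]_y (f y * g y x)%:E = c%:E * \int[mu]_y (f y * riesz (n%:R - 1) x y)%:E)%E.
  rewrite -(ge0_integralTZl mu c0 mfr); last first.
    by move=> y; rewrite lee_fin mulr_ge0 ?riesz_ge0.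
  apply: eq_integral => y _; rewrite -EFinM; congr EFin.
  by rewrite /g -/c rieszC; ring.
by rewrite EFinM muleCA; apply: lee_wpmul2l; rewrite ?lee_fin.
Qed.

End duality.

(** Integrate [threshold_split] in y with phi = f y, and control the last term by
   [interaction_bound]; the parameter lam, proportional to A, is chosen so that half of the
   left-hand side, which is finite, is absorbed. *)
Lemma trace_inequality_gt1 (alpha C0 : R) : 1 < n%:R :> R -> alpha < n%:R ->
  1 < alpha <= 2 -> 0 < C0 ->
  exists2 K : R, 0 < K & forall (A : R) (w u f : E -> R), 0 < A ->
  measurable_fun setT w -> measurable_fun setT u -> measurable_fun setT f ->
  (forall x, 0 <= w x) -> (forall x, 0 <= u x) -> (forall x, 0 <= f x) ->
  (forall x, (\int[mu]_z (riesz (n%:R - alpha) x z * w z)%:E <= A%:E)%E) ->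
  (forall x, ((u x)%:E <= C0%:E * \int[mu]_y (f y * riesz (n%:R - 1) x y)%:E)%E) ->
  (\int[mu]_x (w x * u x `^ alpha)%:E < +oo)%E ->
  (\int[mu]_x (w x * u x `^ alpha)%:E <=
   (K * A)%:E * \int[mu]_y (f y `^ alpha)%:E)%E.
Proof.
move=> n1 alphan alpha12 C00; move: (alpha12) => /andP[a1 a2].
have al0 : 0 < alpha by lra.
have [C Cpos kC] := kernel_composition (introT andP (conj a1 alphan)).
exists (2 * (2 * C0 * (4 * C0 * C) `^ (alpha - 1))).
  by rewrite !mulr_gt0// powR_gt0// !mulr_gt0.
move=> A w u f A0 mw meas_u mf w0 u0 f0 wA uf Xfin.
have duality := duality_bound C00 mw meas_u mf w0 u0 f0 uf al0.
have inter := interaction_bound n1 alpha12 A0 Cpos mw meas_u w0 u0 wA kC.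
set X := (\int[mu]_x (w x * u x `^ alpha)%:E)%E in Xfin duality inter *.
set Y := (\int[mu]_y (f y `^ alpha)%:E)%E.
have X0 : (0 <= X)%E by apply: integral_ge0 => x _; rewrite lee_fin mulr_ge0 ?powR_ge0.
have Y0 : (0 <= Y)%E by apply: integral_ge0 => x _; rewrite lee_fin powR_ge0.
(* With this lam, the coefficient of X in the bound below is 1/2. *)
pose lam := 4 * C0 * C * A.
have lam0 : 0 < lam by rewrite /lam !mulr_gt0.
pose D := 2 * (lam `^ (alpha - 1) * A `^ (2 - alpha)).
have D0 : 0 <= D by rewrite !mulr_ge0 ?powR_ge0.
have li0 : 0 <= lam^-1 by rewrite invr_ge0 ltW.
have muw : measurable_fun setT (fun z => u z * w z) by exact: measurable_funM.
have uw0 z : 0 <= u z * w z by rewrite mulr_ge0.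
have mub (b : R) : measurable_fun setT (fun x => u x `^ b).
  exact: (measurableT_comp (measurable_powR b) meas_u).
pose I y := (\int[mu]_x ((riesz (n%:R - 1) y x * (u x `^ (alpha - 1) * w x)
       * riesz (2 - alpha) y x)%:E * outer_potential (fun z => u z * w z)%R y x))%E.
have Ig0 y x : (0 <= (riesz (n%:R - 1) y x * (u x `^ (alpha - 1) * w x)
       * riesz (2 - alpha) y x)%:E * outer_potential (fun z => u z * w z)%R y x)%E.
  by rewrite mule_ge0 ?outer_potential_ge0// lee_fin !mulr_ge0 ?riesz_ge0 ?powR_ge0.
have mI : measurable_fun setT I.
  apply: (measurable_integral_rV (g := fun y x => ((riesz (n%:R - 1) y x * (u x `^ (alpha - 1) * w x)
       * riesz (2 - alpha) y x)%:E * outer_potential (fun z => u z * w z)%R y x)%E)) => //.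
  apply: emeasurable_funM; last exact: measurable_outer_potential.
  apply/measurable_EFinP; apply: measurable_funM; last exact: measurable_riesz.
  apply: measurable_funM; first exact: measurable_riesz.
  apply: measurable_funM; first exact: (measurableT_comp (mub _) measurable_snd).
  exact: (measurableT_comp mw measurable_snd).
have I0 y : (0 <= I y)%E by exact: integral_ge0.
have mfa : measurable_fun setT (fun y => (f y `^ alpha)%:E).
  apply/measurable_EFinP; exact: (measurableT_comp (measurable_powR _) mf).
have fa0 y : (0 <= (f y `^ alpha)%:E)%E by rewrite lee_fin powR_ge0.
have key y : ((f y)%:E * \int[mu]_x (riesz (n%:R - 1) y x * (u x `^ (alpha - 1) * w x))%:E
    <= D%:E * (f y `^ alpha)%:E + lam^-1%:E * I y)%E.
  have [fy0|fy0] := eqVneq (f y) 0.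
    by rewrite fy0 mul0e adde_ge0// mule_ge0// lee_fin ?powR_ge0.
  have fy : 0 < f y by rewrite lt_def fy0 f0.
  rewrite -EFinM.
  exact: threshold_split.
have bound : (X <= C0%:E * (D%:E * Y + lam^-1%:E * ((2 * (C * A))%:E * X)))%E.
  apply: (le_trans duality); apply: lee_wpmul2l; first by rewrite lee_fin ltW.
  apply: (@le_trans _ _ (\int[mu]_y (D%:E * (f y `^ alpha)%:E + lam^-1%:E * I y))%E).
    apply: ge0_le_integralT => //.
    - apply: emeasurable_funM; first exact/measurable_EFinP.
      apply: (measurable_integral_rV (g := fun y x => (riesz (n%:R - 1) y x * (u x `^ (alpha - 1) * w x))%:E)).
        apply/measurable_EFinP; apply: measurable_funM; first exact: measurable_riesz.
        apply: measurable_funM; first exact: (measurableT_comp (mub _) measurable_snd).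
        exact: (measurableT_comp mw measurable_snd).
      by move=> y x; rewrite lee_fin !mulr_ge0 ?riesz_ge0 ?powR_ge0.
    - by apply: emeasurable_funD; exact: measurable_funeM.
    - move=> y; rewrite mule_ge0 ?lee_fin//; apply: integral_ge0 => x _.
      by rewrite lee_fin !mulr_ge0 ?riesz_ge0 ?powR_ge0.
  have p1 (y : E) : [set: E] y -> (0 <= D%:E * (f y `^ alpha)%:E)%E.
    by move=> _; rewrite mule_ge0// lee_fin.
  have p2 (y : E) : [set: E] y -> (0 <= lam^-1%:E * I y)%E.
    by move=> _; rewrite mule_ge0// lee_fin.
  rewrite (ge0_integralD mu measurableT p1 (measurable_funeM _ mfa) p2 (measurable_funeM _ mI)).
  rewrite (ge0_integralTZl mu D0 mfa fa0) (ge0_integralTZl mu li0 mI I0).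
  by apply: leeD => //; apply: lee_wpmul2l; rewrite ?lee_fin.
have DA : C0 * D = 2 * C0 * (4 * C0 * C) `^ (alpha - 1) * A.
  have AA : A `^ (alpha - 1) * A `^ (2 - alpha) = A.
    rewrite -powRD; last by rewrite (gt_eqF A0) implybT.
    by rewrite (_ : alpha - 1 + (2 - alpha) = 1) ?powRr1 ?(ltW A0)//; ring.
  rewrite /D /lam powRM ?(ltW A0)//; last by rewrite !mulr_ge0// ltW.
  by rewrite -[in RHS]AA; ring.
have KA0 : 0 < 2 * (2 * C0 * (4 * C0 * C) `^ (alpha - 1)) * A.
  by rewrite !mulr_gt0// powR_gt0// !mulr_gt0.
have [Yoo|Yfin] := eqVneq Y +oo%E.
  by rewrite Yoo gt0_muley ?lte_fin// leey.
have Xf : X \is a fin_num by rewrite ge0_fin_numE.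
have Yf : Y \is a fin_num by rewrite ge0_fin_numE// ltey.
move: bound; rewrite -(fineK Xf) -(fineK Yf) -!EFinM !lee_fin.
set x := fine X; set v := fine Y => bound.
have half : C0 * (lam^-1 * (2 * (C * A) * x)) = x / 2.
  by rewrite /lam; field; rewrite ?(gt_eqF C00) ?(gt_eqF Cpos) ?(gt_eqF A0).
rewrite mulrDr half mulrA DA in bound.
move: bound; rewrite -!mulrA; set k := C0 * _; rewrite !mulrA.
by move=> ?; lra.
Qed.

(** For alpha = 1 no factor u is left in the inner integral of [duality_bound], which is then
   the potential of w. *)
Lemma trace_inequality_1 (C0 A : R) (w u f : E -> R) : 1 < n%:R :> R -> 0 < C0 -> 0 < A ->
  measurable_fun setT w -> measurable_fun setT u -> measurable_fun setT f ->
  (forall x, 0 <= w x) -> (forall x, 0 <= u x) -> (forall x, 0 <= f x) ->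
  (forall x, (\int[mu]_z (riesz (n%:R - 1) x z * w z)%:E <= A%:E)%E) ->
  (forall x, ((u x)%:E <= C0%:E * \int[mu]_y (f y * riesz (n%:R - 1) x y)%:E)%E) ->
  (\int[mu]_x (w x * u x `^ 1)%:E <=
   (C0 * A)%:E * \int[mu]_y (f y `^ 1)%:E)%E.
Proof.
move=> n1 C00 A0 mw meas_u mf w0 u0 f0 wA uf.
apply: (le_trans (duality_bound C00 mw meas_u mf w0 u0 f0 uf ltr01)).
rewrite EFinM -muleA; apply: lee_wpmul2l; first by rewrite lee_fin ltW.
have mf1 : measurable_fun setT (fun y => (f y `^ 1)%:E).
  apply/measurable_EFinP; exact: (measurableT_comp (measurable_powR _) mf).
have f10 y : (0 <= (f y `^ 1)%:E)%E by rewrite lee_fin powR_ge0.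
rewrite -(ge0_integralTZl mu (ltW A0) mf1 f10).
have mub (b : R) : measurable_fun setT (fun x => u x `^ b).
  exact: (measurableT_comp (measurable_powR b) meas_u).
apply: ge0_le_integralT => //.
- apply: emeasurable_funM; first exact/measurable_EFinP.
  apply: (measurable_integral_rV (g := fun y x => (riesz (n%:R - 1) y x * (u x `^ (1 - 1) * w x))%:E)).
    apply/measurable_EFinP; apply: measurable_funM; first exact: measurable_riesz.
    apply: measurable_funM; first exact: (measurableT_comp (mub _) measurable_snd).
    exact: (measurableT_comp mw measurable_snd).
  by move=> y x; rewrite lee_fin !mulr_ge0 ?riesz_ge0 ?powR_ge0.
- exact: measurable_funeM.
- move=> y; rewrite mule_ge0 ?lee_fin//; apply: integral_ge0 => x _.
  by rewrite lee_fin !mulr_ge0 ?riesz_ge0 ?powR_ge0.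
move=> y; rewrite powRr1// muleC.
apply: lee_wpmul2r; first by rewrite lee_fin.
apply: le_trans (wA y).
apply: le_of_eq; apply: eq_integral => x _.
by rewrite subrr powRr0 mul1r.
Qed.

End trace.

Lemma trace_inequality (R : realType) (n : nat) (alpha C0 : R) :
  1 <= alpha <= 2 -> alpha < n%:R -> 0 < C0 ->
  exists2 K : R, 0 < K & forall (A : R) (w u f : borel_rV R n -> R), 0 < A ->
  measurable_fun setT w -> measurable_fun setT u -> measurable_fun setT f ->
  (forall x, 0 <= w x) -> (forall x, 0 <= u x) -> (forall x, 0 <= f x) ->
  (forall x, (\int[@lebesgue_rV R n]_z (riesz (n%:R - alpha) x z * w z)%:E <= A%:E)%E) ->
  (forall x, ((u x)%:E <= C0%:E * \int[@lebesgue_rV R n]_y (f y * riesz (n%:R - 1) x y)%:E)%E) ->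
  (\int[@lebesgue_rV R n]_x (w x * u x `^ alpha)%:E < +oo)%E ->
  (\int[@lebesgue_rV R n]_x (w x * u x `^ alpha)%:E <=
   (K * A)%:E * \int[@lebesgue_rV R n]_y (f y `^ alpha)%:E)%E.
Proof.
move=> /andP[a1 a2] an C00; have n1 : 1 < n%:R :> R by exact: le_lt_trans an.
move: a1; rewrite le_eqVlt => /predU1P[a1|a1].
  exists C0 => // A w u f A0 mw meas_u mf w0 u0 f0; rewrite -a1 => wA uf _.
  exact: trace_inequality_1.
have [|K K0 HK] := trace_inequality_gt1 n1 an _ C00; first by rewrite a1.
by exists K.
Qed.

(** * Calculus along lines *)

Section vanishing.
Context {R : realType} {n : nat}.
Variable u : 'rV[R]_n -> R.

Lemma not_supp_eq0 x : ~ supp u x -> u x = 0.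
Proof.
by move=> ux; apply/eqP/negPn/negP => h; apply: ux; exact: subset_closure.
Qed.

Lemma grad_not_supp x : ~ supp u x -> grad u x = 0.
Proof.
move=> ux; apply/rowP => i; rewrite !mxE /partial.
have u0 : \forall y \near x, u y = cst 0 y.
  have : nbhs x (~` supp u).
    by apply: open_nbhs_nbhs; split => //; apply: closed_openC; exact: closed_closure.
  by apply: filterS => y /not_supp_eq0.
by rewrite (near_eq_derive _ u0) derive_cst.
Qed.

Lemma compact_supp_bounded : continuous u -> compact (supp u) ->
  exists2 M : R, 0 <= M & forall x, `|u x| <= M.
Proof.
move=> cu su.
have cmp : compact (u @` supp u).
  by apply: continuous_compact => //; exact: continuous_subspaceT.
have [M [Mr HM]] := compact_bounded cmp.
exists (`|M| + 1); first by rewrite addr_ge0.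
move=> x; have [ux|ux] := pselect (supp u x); last first.
  by rewrite (not_supp_eq0 ux) normr0 addr_ge0.
apply: HM; first by rewrite (le_lt_trans (ler_norm _))// ltrDl.
by exists x.
Qed.

End vanishing.

Section directional_derivative.
Context {R : realType} {n : nat}.
Variable u : 'rV[R]_n -> R.
Hypothesis cu : forall i, continuous (partial i u).
Hypothesis du : forall i x, derivable u x (delta_mx 0 i).

Lemma is_derive_coord (i : 'I_n) (p : 'rV[R]_n) (s : R) :
  is_derive s (1 : R) (fun s : R => u (p + s *: delta_mx 0 i)) (partial i u (p + s *: delta_mx 0 i)).
Proof.
have E : (fun h : R => h^-1 *: (((fun s => u (p + s *: delta_mx 0 i)) \o shift s) (h *: 1) -
     u (p + s *: delta_mx 0 i))) =
  (fun h : R => h^-1 *: ((u \o shift (p + s *: delta_mx 0 i)) (h *: delta_mx 0 i) -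
     u (p + s *: delta_mx 0 i))).
  apply/funext => h /=; congr (_ *: (u _ - _)).
  by rewrite scalerDl /GRing.scale/= mulr1 addrCA.
apply: DeriveDef.
  by rewrite /derivable E; exact: du.
by rewrite /derive E.
Qed.

Lemma mvt_coord (i : 'I_n) (p : 'rV[R]_n) (d : R) : exists2 s : R, `|s| <= `|d| &
  u (p + d *: delta_mx 0 i) - u p = d * partial i u (p + s *: delta_mx 0 i).
Proof.
pose phi (s : R) := u (p + s *: delta_mx 0 i).
have dphi (s : R) : is_derive s (1 : R) phi (partial i u (p + s *: delta_mx 0 i)).
  exact: is_derive_coord.
have cphi a b : {within `[a, b], continuous phi}.
  by apply: derivable_within_continuous => s _; have [] := dphi s.
have phi0 : u p = phi 0 by rewrite /phi scale0r addr0.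
have [d0|d0] := leP 0 d.
  have [c] := MVT_segment d0 (fun s _ => dphi s) (cphi 0 d).
  rewrite in_itv/= subr0 => /andP[c0 cd] E; exists c.
    by rewrite !ger0_norm.
  by rewrite phi0 mulrC.
have [c] := MVT_segment (ltW d0) (fun s _ => dphi s) (cphi d 0).
rewrite in_itv/= sub0r => /andP[c0 cd] E; exists c.
  by rewrite !ler0_norm ?lerN2// ltW.
by rewrite phi0 -opprB E mulrN opprK mulrC.
Qed.

(** The increment is the sum of n increments
   along the axes, each of them given by the mean value theorem at a point close to x. *)
Lemma directional_increment (x v : 'rV[R]_n) (e : R) : 0 < e ->
  (\forall h \near 0, `|u (x + h *: v) - u x -
     h * \sum_i v 0 i * partial i u x| <= `|h| * e)%R.
Proof.
move=> e0.
pose M : R := \sum_i `|v 0 i| + 1.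
have M0 : 0 < M by rewrite ltr_wpDl// sumr_ge0.
have near_x i : \forall z \near x, `|partial i u x - partial i u z| < e / M.
  have /cvgrPdist_lt := @cu i x; apply; exact: divr_gt0.
have /filter_forall/nbhs_ballP[r /= r0 Hr] := near_x.
have h0 : \forall h \near (0 : R), `|h| * (`|v| + 1) < r.
  have rv0 : 0 < r / (`|v| + 1) by rewrite divr_gt0// ltr_wpDl.
  apply/nbhs_ballP; exists (r / (`|v| + 1)) => //= h.
  by rewrite /ball/= sub0r normrN -ltr_pdivlMr// ltr_wpDl.
near=> h.
have hr : `|h| * (`|v| + 1) < r by near: h.
(* From x to x + h *: v along the axes, one coordinate at a time. *)
pose vk k : 'rV[R]_n := \row_i (if (i < k)%N then v 0 i else 0).
pose p k := x + h *: vk k.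
have pn : p n = x + h *: v.
  by rewrite /p; congr (_ + _ *: _); apply/rowP => i; rewrite mxE ltn_ord.
have p0 : p 0%N = x.
  by rewrite /p (_ : vk 0%N = 0) ?scaler0 ?addr0//; apply/rowP => i; rewrite !mxE.
have pS (i : 'I_n) : p i.+1 = p i + (h * v 0 i) *: delta_mx 0 i.
  rewrite /p -addrA -scalerA -scalerDr; congr (_ + _ *: _); apply/rowP => j.
  rewrite !mxE /= ltnS leq_eqVlt.
  have [->|ij] := eqVneq j i; first by rewrite eqxx/= ltnn mulr1 add0r.
  rewrite (negbTE ij : (j == i :> nat) = false) mulr0 addr0//.
have tele : u (x + h *: v) - u x = \sum_(i < n) (u (p i.+1) - u (p i)).
  rewrite -pn -p0 -(big_mkord xpredT (fun i => u (p i.+1) - u (p i))).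
  by rewrite telescope_sumr.
rewrite tele mulr_sumr -sumrB.
apply: (le_trans (ler_norm_sum _ _ _)).
apply: (@le_trans _ _ (\sum_(i < n) `|h| * `|v 0 i| * (e / M))).
  apply: ler_sum => i _; rewrite pS.
  have [s hs ->] := mvt_coord i (p i) (h * v 0 i).
  rewrite [h * (v 0 i * partial i u x)]mulrA -mulrBr normrM normrM.
  apply: ler_wpM2l; first by rewrite mulr_ge0.
  rewrite distrC; apply/ltW; apply: Hr.
  rewrite -ball_normE /= /p -addrA opprD addNKr normrN.
  have hv0 : 0 <= `|h| * `|v| by rewrite mulr_ge0.
  have hvr : `|h| * `|v| < r.
    by apply: le_lt_trans hr; rewrite ler_wpM2l// lerDl.
  apply: le_lt_trans hvr; apply: norm_ler_coord => // j.
  rewrite !mxE /=; have [->|ij] := eqVneq j i.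
    rewrite ltnn mulr0 add0r mulr1 (le_trans hs)// normrM ler_wpM2l//.
    exact: ler_coord_norm.
  rewrite mulr0 addr0; case: ifPn => _; last by rewrite mulr0 normr0.
  by rewrite normrM ler_wpM2l// ler_coord_norm.
rewrite -mulr_suml -mulr_sumr -mulrA ler_wpM2l// mulrC -mulrA ger_pMr//.
by rewrite mulrC ler_pdivrMr// mul1r lerDl.
Unshelve. all: by end_near. Qed.

Lemma is_derive_line (x v : 'rV[R]_n) (t : R) :
  is_derive t (1 : R) (fun t : R => u (x + t *: v))
    (\sum_i v 0 i * partial i u (x + t *: v)).
Proof.
set S := \sum_i _.
have cv : (h^-1 *: (((fun t : R => u (x + t *: v)) \o shift t) (h *: 1) -
     u (x + t *: v))) @[h --> (0 : R)^'] --> S.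
  apply/cvgrPdist_le => e e0.
  have := directional_increment (x + t *: v) v e0.
  apply: filterS => h Hh h0 /=.
  have nh0 : 0 < `|h| by rewrite normr_gt0.
  have -> : x + (h *: (1 : R) + t) *: v = x + t *: v + h *: v.
    by rewrite scalerDl [h *: 1]mulr1 -addrA [t *: v + _]addrC.
  by rewrite -(ler_pM2l nh0) -normrM mulrBr mulVKf// distrC.
apply: DeriveDef; first by apply/cvg_ex; exists S.
exact: cvg_lim.
Qed.

Lemma continuous_line (g : 'rV[R]_n -> R) (x v : 'rV[R]_n) :
  continuous g -> continuous (fun t : R => g (x + t *: v)).
Proof.
move=> cg t; apply: (@continuous_comp _ _ _ (fun t : R => x + t *: v) g); last exact: cg.
by apply: cvgD; [exact: cvg_cst|apply: cvgZr_tmp; exact: cvg_id].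
Qed.

Lemma ray_bound (x v : 'rV[R]_n) (b : R) : 0 < b -> u (x + b *: v) = 0 ->
  ((`|u x|)%:E <= \int[@lebesgue_measure R]_(t in `[0%R, b])
     (`|\sum_i v 0 i * partial i u (x + t *: v)|)%:E)%E.
Proof.
move=> b0 ub.
pose phi (t : R) := u (x + t *: v).
pose psi (t : R) := \sum_i v 0 i * partial i u (x + t *: v).
have dphi (t : R) : is_derive t (1 : R) phi (psi t) by exact: is_derive_line.
have cphi : continuous phi.
  move=> t; apply: differentiable_continuous; apply/derivable1_diffP.
  by have [] := dphi t.
have cpsi : continuous psi.
  apply: (continuous_big (op := +%R) (x0 := 0 : R)); first exact: add_continuous.
  move=> i _ t.
  by apply: cvgMl_tmp; exact: continuous_line.
have E : (\int[@lebesgue_measure R]_(t in `[0%R, b]) (psi t)%:E = (phi b)%:E - (phi 0)%:E)%E.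
  apply: continuous_FTC2 => //.
  - exact: continuous_subspaceT.
  - split; [by move=> t _; have [] := dphi t
    |apply: cvg_at_right_filter; exact: cphi|apply: cvg_at_left_filter; exact: cphi].
  - by move=> t _; rewrite derive1E; have [_ ->] := dphi t.
have -> : `|u x|%:E = `|\int[@lebesgue_measure R]_(t in `[0%R, b]) (psi t)%:E|%E.
  by rewrite E /phi ub scale0r addr0 -EFinB sub0r /abse normrN.
apply: (le_abse_integral (@lebesgue_measure R)) => //.
by apply/measurable_EFinP/measurable_funTS; exact: continuous_measurable_fun.
Qed.

End directional_derivative.

(** * Representation of a function by its gradient *)

Section subrepresentation.
Context {R : realType} {n : nat}.
Local Notation E := (borel_rV R n).
Local Notation mu := (@lebesgue_rV R n).
Local Notation leb := (@lebesgue_measure R).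

(** A convenient set of directions for averaging: it has positive measure, avoids the origin
   and, being a ball of the sup norm, has a volume that is known. *)
Definition cube (v : 'rV[R]_n) : bool := `|(const_mx 2 : 'rV[R]_n) - v| < 1.

Lemma cube_coord v i : cube v -> 1 < v 0 i < 3.
Proof.
rewrite /cube => h; have := le_lt_trans (ler_coord_norm (const_mx 2 - v) i) h.
by rewrite !mxE ltr_norml => /andP[h1 h2]; apply/andP; split; lra.
Qed.

Lemma cube_norm v : (0 < n)%N -> cube v -> 1 < `|v| <= 3.
Proof.
move=> n0 cv; apply/andP; split.
  have /andP[h _] := cube_coord (Ordinal n0) cv.
  by rewrite (lt_le_trans h)// (le_trans (ler_norm _))// ler_coord_norm.
apply: norm_ler_coord => // i; have /andP[h1 h2] := cube_coord i cv.
by rewrite ger0_norm; lra.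
Qed.

Lemma partial_le_enorm_grad (u : 'rV[R]_n -> R) i x : `|partial i u x| <= enorm (grad u x).
Proof. by have := ler_coord_enorm (grad u x) i; rewrite mxE. Qed.

Section fixed_function.
Variable u : 'rV[R]_n -> R.
Hypothesis n0 : (0 < n)%N.
Hypothesis cu : forall i, continuous (partial i u).
Hypothesis du : forall i x, derivable u x (delta_mx 0 i).
Hypothesis su : compact (supp u).

Let f (x : E) : R := enorm (grad u x).

Let f0 x : 0 <= f x. Proof. exact: enorm_ge0. Qed.

Lemma measurable_enorm_grad : measurable_fun setT f.
Proof.
apply: measurable_enorm => i.
rewrite [X in measurable_fun _ X](_ : _ = partial i u); last first.
  by apply/funext => x; rewrite mxE.
exact: continuous_measurable_rV.
Qed.

Lemma compact_supp_vanish : exists2 M : R, 0 < M & forall x, M < `|x| -> u x = 0.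
Proof.
have [M [Mr HM]] := compact_bounded su.
exists (`|M| + 1); first by rewrite ltr_wpDl.
move=> x Mx; apply: not_supp_eq0 => ux.
have : `|x| <= `|M| + 1.
  by apply: HM => //; rewrite (le_lt_trans (ler_norm _))// ltrDl.
by rewrite leNgt Mx.
Qed.

(** Fundamental theorem of calculus along the half-line of direction v, which leaves the
   support of u. *)
Lemma line_integral_bound (x v : 'rV[R]_n) : cube v ->
  ((`|u x|)%:E <= (3 * n%:R)%:E *
     \int[leb]_t ((0 < t)%R%:R * f (x + t *: v)%R)%:E)%E.
Proof.
move=> cv; have [M M0 HM] := compact_supp_vanish.
have /andP[v1 v3] := cube_norm n0 cv.
(* The norm of v is larger than 1, so at time b the ray has left the support. *)
pose b := M + `|x| + 1.
have b0 : 0 < b by rewrite /b ltr_wpDl// addr_ge0// ltW.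
have ub : u (x + b *: v) = 0.
  apply: HM.
  have h : b <= `|b *: v| by rewrite normrZ (gtr0_norm b0) ler_peMr// ltW.
  have : `|b *: v| <= `|x + b *: v| + `|x|.
    have E1 : b *: v = (x + b *: v) - x by rewrite addrAC subrr add0r.
    by rewrite [in leLHS]E1; exact: ler_normB.
  by rewrite /b in h *; lra.
apply: (le_trans (ray_bound cu du b0 ub)).
have mline (g : 'rV[R]_n -> R) : continuous g -> measurable_fun setT (fun t : R => g (x + t *: v)).
  by move=> cg; apply: continuous_measurable_fun; exact: continuous_line.
have mS : measurable_fun setT (fun t : R => `|\sum_i v 0 i * partial i u (x + t *: v)|).
  apply: measurableT_comp => //; apply: measurable_sum => i.
  by apply: measurable_funM => //; exact: mline.
have mfl : measurable_fun setT (fun t : R => f (x + t *: v)).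
  apply: measurable_enorm => i.
  rewrite [X in measurable_fun _ X](_ : _ = fun t : R => partial i u (x + t *: v)).
    exact: mline.
  by apply/funext => t; rewrite mxE.
have mI : measurable_fun setT (fun t : measurableTypeR R => ((0 < t)%R%:R * f (x + t *: v)%R)%:E).
  apply/measurable_EFinP; apply: measurable_funM => //.
  by apply: measurable_fun_bool_real; apply: measurable_fun_ltr.
have c0 : 0 <= 3 * n%:R :> R by rewrite mulr_ge0.
have I0 t : (0 <= ((0 < t)%R%:R * f (x + t *: v)%R)%:E)%E by rewrite lee_fin mulr_ge0.
rewrite -(ge0_integralTZl leb c0 mI I0).
rewrite -integral_itv_obnd_cbnd; last first.
  by apply/measurable_EFinP/measurable_funTS.
apply: (@le_trans _ _ (\int[leb]_(t in `]0%R, b])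
   ((3 * n%:R)%:E * ((0 < t)%R%:R * f (x + t *: v)%R)%:E))%E); last first.
  apply: ge0_subset_integral => //.
  - exact: measurable_funeM.
  - by move=> t _; rewrite mule_ge0// lee_fin.
apply: ge0_le_integral => //.
- by apply/measurable_EFinP/measurable_funTS.
- by apply: measurable_funTS; exact: measurable_funeM.
move=> t /=; rewrite in_itv/= => /andP[t0 _].
rewrite t0 mul1r -EFinM lee_fin (le_trans (ler_norm_sum _ _ _))//.
have -> : 3 * n%:R * f (x + t *: v) = \sum_(i < n) 3 * f (x + t *: v).
  by rewrite sumr_const card_ord -mulr_natr; ring.
apply: ler_sum => i _; rewrite normrM ler_pM// ?partial_le_enorm_grad//.
have /andP[h1 h2] := cube_coord i cv.
by rewrite ger0_norm; lra.
Qed.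


Let Phi (v : E) (t : measurableTypeR R) (x : 'rV[R]_n) : R :=
  (cube v)%:R * ((0 < t)%R%:R * f (x + t *: (v : 'rV[R]_n))).

Let Psi (y : E) (t : measurableTypeR R) (x : 'rV[R]_n) : R :=
  (0 < t)%R%:R * (t `^ (- 1)) ^+ n *
  ((cube (t `^ (- 1) *: ((y : 'rV[R]_n) - x)))%:R * f y).

Let measurable_cube d (T : measurableType d) (F : T -> E) :
  measurable_fun setT F -> measurable_fun setT (fun t => (cube (F t))%:R : R).
Proof.
move=> mF; apply: measurable_fun_bool_real; apply: measurable_fun_ltr => //.
by apply: (@measurable_dist _ _ _ _ (cst (const_mx 2 : 'rV[R]_n) : T -> E)).
Qed.

Let measurable_ind : measurable_fun setT (fun t : measurableTypeR R => (0 < t)%R%:R : R).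
Proof. by apply: measurable_fun_bool_real; apply: measurable_fun_ltr. Qed.

Let mPhi x : measurable_fun setT (fun p : E * measurableTypeR R => (Phi p.1 p.2 x)%:E).
Proof.
have m1 : measurable_fun setT (fun p : E * measurableTypeR R => (x + p.2 *: (p.1 : 'rV[R]_n)) : E).
  apply: measurable_fun_rVP => i.
  rewrite [X in measurable_fun _ X](_ : _ =
    (fun p : E * measurableTypeR R => x 0 i + p.2 * (p.1 : 'rV[R]_n) 0 i)); last first.
    by apply/funext => p; rewrite !mxE.
  apply: measurable_funD => //; apply: measurable_funM => //.
  exact: (measurableT_comp (measurable_coord i) measurable_fst).
apply/measurable_EFinP; apply: measurable_funM; first exact: measurable_cube.
apply: measurable_funM; first exact: (measurableT_comp measurable_ind measurable_snd).
exact: (measurableT_comp measurable_enorm_grad m1).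
Qed.

Let mPsi x : measurable_fun setT (fun p : E * measurableTypeR R => (Psi p.1 p.2 x)%:E).
Proof.
have mpow : measurable_fun setT (fun p : E * measurableTypeR R => p.2 `^ (- 1)).
  exact: (measurableT_comp (measurable_powR _) measurable_snd).
have m1 : measurable_fun setT (fun p : E * measurableTypeR R =>
    (p.2 `^ (- 1) *: ((p.1 : 'rV[R]_n) - x)) : E).
  apply: measurable_fun_rVP => i.
  rewrite [X in measurable_fun _ X](_ : _ =
    (fun p : E * measurableTypeR R => p.2 `^ (- 1) * ((p.1 : 'rV[R]_n) 0 i - x 0 i))); last first.
    by apply/funext => p; rewrite !mxE.
  apply: measurable_funM => //; apply: measurable_funB => //.
  exact: (measurableT_comp (measurable_coord i) measurable_fst).
apply/measurable_EFinP; apply: measurable_funM.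
  apply: measurable_funM; first exact: (measurableT_comp measurable_ind measurable_snd).
  exact: measurable_funX.
apply: measurable_funM; first exact: measurable_cube.
exact: (measurableT_comp measurable_enorm_grad measurable_fst).
Qed.

Let Phi0 v t x : (0 <= (Phi v t x)%:E)%E.
Proof. by rewrite lee_fin !mulr_ge0. Qed.

Let Psi0 y t x : (0 <= (Psi y t x)%:E)%E.
Proof. by rewrite lee_fin !mulr_ge0// exprn_ge0// powR_ge0. Qed.

(** For fixed t the substitution y = x + t v, of Jacobian t^n. *)
Let change_of_variable x t : (\int[mu]_v (Phi v t x)%:E = \int[mu]_y (Psi y t x)%:E)%E.
Proof.
rewrite /Phi /Psi; have [t0|t0] := ltP 0 t; last first.
  under eq_integral do rewrite mul0r mulr0.
  by under [in RHS]eq_integral do rewrite !mul0r.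
have tn0 : t != 0 by rewrite gt_eqF.
pose G (y : E) : \bar R := ((cube (t^-1 *: ((y : 'rV[R]_n) - x)))%:R * f y)%:E.
have mG : measurable_fun setT G.
  apply/measurable_EFinP; apply: measurable_funM; last exact: measurable_enorm_grad.
  apply: measurable_cube; apply: measurable_fun_rVP => i.
  rewrite [X in measurable_fun _ X](_ : _ =
    (fun y : E => t^-1 * ((y : 'rV[R]_n) 0 i - x 0 i))); last first.
    by apply/funext => p; rewrite !mxE.
  apply: measurable_funM => //; apply: measurable_funB => //.
  exact: measurable_coord.
have G0 y : (0 <= G y)%E by rewrite lee_fin mulr_ge0.
have tn : 0 <= t^-1 ^+ n by rewrite exprn_ge0// invr_ge0 ltW.
transitivity (\int[mu]_v G (x + t *: (v : 'rV[R]_n))%R)%E.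
  apply: eq_integral => v _; rewrite /G mul1r.
  by rewrite [X in cube (_ *: X)]addrAC subrr add0r scalerA mulVf// scale1r.
rewrite (lebesgue_rV_affine x t0 mG G0) -(ge0_integralTZl mu tn mG G0).
by apply: eq_integral => y _; rewrite /G mul1r powR_inv1 ?(ltW t0).
Qed.

(** For fixed y only the times t comparable to |x - y| see y in the dilated cube; on them t^-n
   is comparable to |x - y|^-n, and they form an interval of length comparable to |x - y|. *)
Let radial_slice x y : (\int[leb]_t (Psi y t x)%:E <=
  (3 ^+ n * (f y * riesz (n%:R - 1) x y))%:E)%E.
Proof.
pose rho := `|(x : 'rV[R]_n) - (y : 'rV[R]_n)|.
have [r0|r0] := eqVneq rho 0.
  have yx : (y : 'rV[R]_n) - x = 0.
    by apply/eqP; rewrite -normr_eq0 distrC -/rho r0.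
  under eq_integral do rewrite /Psi yx scaler0.
  have c0 : cube 0 = false.
    by apply/negP => /(cube_coord (Ordinal n0)); rewrite mxE; lra.
  rewrite c0; under eq_integral do rewrite mul0r mulr0.
  by rewrite integral0 lee_fin !mulr_ge0 ?exprn_ge0 ?riesz_ge0.
have rho0 : 0 < rho by rewrite lt_def r0 normr_ge0.
pose c := f y * (rho / 3)^-1 ^+ n.
have c0 : 0 <= c by rewrite mulr_ge0// exprn_ge0// invr_ge0 divr_ge0// ltW.
apply: (@le_trans _ _ (\int[leb]_(t in `[(rho / 3)%R, rho]) (cst c%:E t))%E).
  rewrite [leRHS]integral_mkcond; apply: ge0_le_integralT => //.
  - exact: (measurableT_comp (mPsi x) (pair1_measurable y)).
  - by apply/(measurable_restrictT _ _).1 => //; exact: measurable_cst.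
  move=> t; rewrite patchE /Psi.
  have [t0|t0] := ltP 0 t; last first.
    by rewrite !mul0r; case: ifP => // _; rewrite lee_fin.
  rewrite mul1r powR_inv1 ?(ltW t0)//.
  have [cv|cv] := boolP (cube _); last by rewrite mul0r mulr0; case: ifP => // _; rewrite lee_fin.
  have /andP[h1 h2] := cube_norm n0 cv.
  rewrite normrZ gtr0_norm ?invr_gt0// distrC -/rho in h1 h2.
  rewrite ltr_pdivlMl// mulr1 in h1.
  rewrite ler_pdivrMl// in h2.
  (* Only the times t with rho / 3 <= t < rho contribute. *)
  have t3 : rho / 3 <= t by rewrite ler_pdivrMr.
  rewrite mem_set; last by rewrite /= in_itv/= t3 (ltW h1).
  rewrite mul1r lee_fin /c mulrC ler_wpM2l//.
  have r3 : 0 < rho / 3 by rewrite divr_gt0.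
  by rewrite lerXn2r ?nnegrE ?invr_ge0 ?(ltW t0) ?(ltW r3)// lef_pV2.
rewrite integral_cst//; have lebE := @lebesgue_measure_itv R `[rho / 3, rho].
rewrite [X in (_ * X)%E]lebE/= lte_fin.
case: ifPn => _; last by rewrite mule0 lee_fin !mulr_ge0 ?exprn_ge0 ?riesz_ge0.
rewrite -EFinB -EFinM lee_fin /c invf_div exprMn exprVn.
have -> : riesz (n%:R - 1) x y = rho ^- n * rho.
  rewrite /riesz -/rho opprB addrC powRD; last by rewrite (gt_eqF rho0) implybT.
  by rewrite powRr1 ?(ltW rho0)// powR_invn ?(ltW rho0).
have k0 : 0 <= f y * (3 ^+ n * rho ^- n).
  by rewrite !mulr_ge0 ?invr_ge0 ?exprn_ge0// ltW.
rewrite (_ : 3 ^+ n * _ = f y * (3 ^+ n * rho ^- n) * rho); last by ring.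
by rewrite ler_wpM2l// gerBl divr_ge0// ltW.
Qed.

(** The bounds along half-lines starting at x are averaged over the directions in the cube, and
   the order of integration between the direction and the time is exchanged. *)
Lemma subrepresentation x :
  ((`|u x|)%:E <= (3 * n%:R * 3 ^+ n)%:E *
     \int[mu]_y (f y * riesz (n%:R - 1) x y)%:E)%E.
Proof.
have c0 : 0 <= 3 * n%:R :> R by rewrite mulr_ge0.
have mu_cube : mu [set v : E | cube v] = (2 ^+ n)%:E.
  have E1 := lebesgue_rV_ball (const_mx 2 : 'rV[R]_n) (ltr01 : 0 < 1 :> R).
  rewrite mulr1 in E1; rewrite -E1; congr (mu _).
  by apply/seteqP; split=> v; rewrite -ball_normE.
have mcube : measurable [set v : E | cube v].
  rewrite (_ : [set v : E | cube v] = ball (const_mx 2 : 'rV[R]_n) 1); first exact: measurable_ball_rV.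
  by apply/seteqP; split=> v; rewrite -ball_normE.
have lhs : ((`|u x|)%:E <= \int[mu]_(v in [set v : E | cube v]) (`|u x|)%:E)%E.
  rewrite [leRHS]integral_cst// [X in (_ * X)%E]mu_cube -EFinM lee_fin.
  by rewrite ler_peMr// exprn_ege1// ler1n.
apply: (le_trans lhs); rewrite integral_bool_restrict.
have mPhi1 : measurable_fun setT (fun v : E => \int[leb]_t (Phi v t x)%:E)%E.
  exact: (measurable_fun_fubini_tonelli_F (m2 := leb) _ (mPhi x) (fun p => Phi0 p.1 p.2 x)).
apply: (@le_trans _ _ (\int[mu]_v ((3 * n%:R)%:E * \int[leb]_t (Phi v t x)%:E))%E).
  apply: ge0_le_integralT => //.
  - apply/measurable_EFinP; apply: measurable_funM => //; exact: measurable_cube.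
  - exact: measurable_funeM.
  move=> v; case: (boolP (cube v)) => cv; last first.
    by rewrite mul0r mule_ge0 ?lee_fin//; apply: integral_ge0.
  rewrite mul1r /Phi cv; under eq_integral do rewrite mul1r.
  exact: line_integral_bound.
rewrite (ge0_integralTZl mu c0 mPhi1); last by move=> v; exact: integral_ge0.
rewrite EFinM -muleA; apply: lee_wpmul2l; first by rewrite lee_fin.
rewrite (fubini_tonelli (m1 := mu) (m2 := leb) (fun p => (Phi p.1 p.2 x)%:E) (mPhi x) (fun p => Phi0 p.1 p.2 x))/=.
under eq_integral do rewrite change_of_variable.
rewrite -(fubini_tonelli (m1 := mu) (m2 := leb) (fun p => (Psi p.1 p.2 x)%:E) (mPsi x) (fun p => Psi0 p.1 p.2 x))/=.
have mfr : measurable_fun setT (fun y => (f y * riesz (n%:R - 1) x y)%:E).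
  apply/measurable_EFinP; apply: measurable_funM; first exact: measurable_enorm_grad.
  exact: measurable_riesz.
have c3 : 0 <= 3 ^+ n :> R by rewrite exprn_ge0.
rewrite -(ge0_integralTZl mu c3 mfr); last first.
  by move=> y; rewrite lee_fin mulr_ge0 ?riesz_ge0.
have mPsi1 : measurable_fun setT (fun y : E => \int[leb]_t (Psi y t x)%:E)%E.
  exact: (measurable_fun_fubini_tonelli_F (m2 := leb) _ (mPsi x) (fun p => Psi0 p.1 p.2 x)).
have Psi10 (y : E) : (0 <= \int[leb]_t (Psi y t x)%:E)%E by exact: integral_ge0.
apply: ge0_le_integralT; [exact: mPsi1|exact: measurable_funeM|exact: Psi10|].
by move=> y; rewrite -EFinM; exact: radial_slice.
Qed.

End fixed_function.
End subrepresentation.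

(** * The Stummel modulus and the inequality *)

Section weight.
Context {R : realType} {n : nat}.
Local Notation E := (borel_rV R n).
Local Notation mu := (@lebesgue_rV R n).
Variables (q : E -> R) (s r b : R) (x0 : 'rV[R]_n).
Hypotheses (n0 : (0 < n)%N) (s0 : 0 < s) (r0 : 0 < r).
Hypotheses (mq : measurable_fun setT q) (q0 : forall x, 0 <= q x).
Hypothesis qb : forall x : 'rV[R]_n, (\int[mu]_(y in eball x r)
  (q y / enorm (x - (y : 'rV[R]_n)) `^ s)%:E <= b%:E)%E.

Let in_ball (x : 'rV[R]_n) (y : E) : R := (enorm (x - (y : 'rV[R]_n)) < r)%R%:R.

Let k (x : 'rV[R]_n) (y : E) : R := in_ball x y * (q y / enorm (x - (y : 'rV[R]_n)) `^ s).

Let w (y : E) : R := in_ball x0 y * q y.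

Let mball x : measurable_fun setT (in_ball x).
Proof. apply: measurable_fun_bool_real; apply: measurable_fun_ltr => //.
exact: measurable_edist. Qed.

Let mk x : measurable_fun setT (k x).
Proof.
apply: measurable_funM => //; apply: measurable_funM => //.
rewrite [X in measurable_fun _ X](_ : _ = (fun y : E => enorm (x - (y : 'rV[R]_n)) `^ (- s))).
  exact: (measurableT_comp (measurable_powR _) (measurable_edist x)).
by apply/funext => y; rewrite powRN.
Qed.

Let mw : measurable_fun setT w. Proof. exact: measurable_funM. Qed.

Let k0 x y : 0 <= k x y.
Proof. by rewrite !mulr_ge0// invr_ge0 powR_ge0. Qed.

Let w0 y : 0 <= w y. Proof. by rewrite mulr_ge0. Qed.

Let kb x : (\int[mu]_y (k x y)%:E <= b%:E)%E.
Proof. by rewrite -integral_bool_restrict; exact: qb. Qed.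

(** In the ball of centre x0 the kernel is at least r^-s. *)
Lemma weight_mass : (\int[mu]_y (w y)%:E <= (r `^ s * b)%:E)%E.
Proof.
have rs0 : 0 <= r `^ s by exact: powR_ge0.
have mx := measurable_set1_rV x0.
have mwE : measurable_fun setT (fun y => (w y)%:E) by exact/measurable_EFinP.
have mkE : measurable_fun setT (fun y => (k x0 y)%:E) by exact/measurable_EFinP.
have w0E y : [set: E] y -> (0 <= (w y)%:E)%E by rewrite lee_fin.
have k0E y : (0 <= (k x0 y)%:E)%E by rewrite lee_fin.
(* At the centre x0 the quotient is 0 by convention, hence no bound for w. *)
rewrite (ge0_negligible_integral mx measurableT mwE w0E (lebesgue_rV_set1 x0 n0)).
have mTx : measurable ([set: E] `\` [set x0 : E]) by exact: measurableD.
apply: (@le_trans _ _ (\int[mu]_y ((r `^ s)%:E * (k x0 y)%:E))%E); last first.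
  by rewrite (ge0_integralTZl mu rs0 mkE k0E) EFinM lee_wpmul2l// lee_fin.
apply: (@le_trans _ _ (\int[mu]_(y in [set: E] `\` [set x0 : E]) ((r `^ s)%:E * (k x0 y)%:E))%E).
  apply: ge0_le_integral => //.
  - by move=> y _; exact: w0E.
  - exact: measurable_funTS.
  - by apply: measurable_funTS; exact: measurable_funeM.
  move=> y [_ /= yx]; rewrite -EFinM lee_fin /w /k /in_ball.
  case: (ltP (enorm _) r) => h; last by rewrite !mul0r mulr0.
  rewrite !mul1r mulrCA ler_peMr//.
  have e0 : 0 < enorm (x0 - y).
    rewrite (lt_le_trans _ (norm_le_enorm _))// normr_gt0 subr_eq0.
    by apply/eqP => h'; apply: yx.
  rewrite ler_pdivlMr ?powR_gt0// mul1r.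
  by apply: ge0_ler_powR; rewrite ?nnegrE ?(ltW e0) ?(ltW r0) ?(ltW s0)// ltW.
apply: ge0_subset_integral => //; first exact: measurable_funeM.
by move=> y _; rewrite mule_ge0// lee_fin.
Qed.

(** Close to y the potential is that of the hypothesis; at distances at least r the kernel is
   at most r^-s, and [weight_mass] bounds the rest. Hence the scale r is enough, although two
   points of the ball can be at a distance close to 2 r. *)
Lemma weight_potential (y : E) :
  (\int[mu]_z (riesz s y z * w z)%:E <= (2 * n%:R `^ s * b)%:E)%E.
Proof.
have ns0 : 0 <= n%:R `^ s :> R by exact: powR_ge0.
have nrs0 : 0 <= n%:R `^ s * r `^ (- s) :> R by rewrite mulr_ge0// powR_ge0.
apply: (@le_trans _ _ (\int[mu]_z (n%:R `^ s * k y z + n%:R `^ s * r `^ (- s) * w z)%:E)%E).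
  apply: ge0_le_integralT.
  - apply/measurable_EFinP; apply: measurable_funM => //; exact: measurable_riesz.
  - by apply/measurable_EFinP; apply: measurable_funD; apply: measurable_funM.
  - by move=> z; rewrite lee_fin mulr_ge0 ?riesz_ge0.
  move=> z; rewrite lee_fin.
  have H := norm_powRN_le ((y : 'rV[R]_n) - (z : 'rV[R]_n)) n0 s0.
  apply: (le_trans (ler_wpM2r (w0 z) H)).
  rewrite /k /w /in_ball; case: (ltP (enorm ((y : 'rV[R]_n) - (z : 'rV[R]_n))) r) => h; last first.
    rewrite /= mulr0n mul0r mulr0 add0r ler_wpM2r ?mulr_ge0// ler_wpM2l// -powRN.
    by apply: powRN_anti => //; exact: ltW.
  rewrite /= mulr1n mul1r -[leLHS]addr0 lerD//; last by rewrite !mulr_ge0 ?powR_ge0.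
  rewrite -mulrA ler_wpM2l// mulrC ler_wpM2r ?invr_ge0 ?powR_ge0//.
  by case: (ltP (enorm (x0 - z)) r) => _; rewrite ?mul1r ?mul0r.
rewrite (ge0_integral_lin mu measurableT ns0 nrs0 (mk y) mw (k0 y) w0).
rewrite (_ : 2 * n%:R `^ s * b = n%:R `^ s * b + n%:R `^ s * r `^ (- s) * (r `^ s * b)).
  by rewrite EFinD !(EFinM _ b) (EFinM _ (r `^ s * b)); apply: leeD; apply: lee_wpmul2l; rewrite ?lee_fin// weight_mass.
have rs0 : r `^ s != 0 by rewrite gt_eqF// powR_gt0.
by rewrite powRN; field.
Qed.

End weight.

Lemma stummel_modulusP (R : realType) n (alpha p r : R) (V : 'rV[R]_n -> R) x : 1 <= p ->
  (\int[@lebesgue_rV R n]_(y in eball x r)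
     (`|V y| `^ p / enorm (x - (y : 'rV[R]_n)) `^ (n%:R - alpha))%:E
   <= stummel_modulus alpha p V r `^ p)%E.
Proof.
move=> p1; have p0 : 0 < p by exact: lt_le_trans p1.
set I := (X in (X <= _)%E).
have I0 : (0 <= I)%E.
  by apply: integral_ge0 => y _; rewrite lee_fin divr_ge0// powR_ge0.
have Ile : (I `^ p^-1 <= stummel_modulus alpha p V r)%E.
  by apply: ereal_sup_ubound; exists x.
have -> : (I = (I `^ p^-1) `^ p)%E.
  by rewrite -poweRrM mulVf ?gt_eqF// poweRe1.
apply: gt0_ler_poweR => //; first exact: ltW.
  by rewrite in_itv/= poweR_ge0 leey.
by rewrite in_itv/= leey andbT (le_trans _ Ile)// poweR_ge0.
Qed.

Theorem theorem1p2 (R : realType) (n : nat) (alpha : R) :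
  1 <= alpha <= 2 -> alpha < n%:R ->
  exists C : R, 0 < C /\
    forall p : R, 1 <= p ->
    forall V : 'rV[R]_n -> R, bounded_stummel alpha p V ->
    forall (x0 : 'rV[R]_n) (r0 : R), 0 < r0 ->
    forall u : 'rV[R]_n -> R,
      test_function u -> supp u `<=` eball x0 r0 ->
      (\int[@lebesgue_rV R n]_(x in eball x0 r0)
         (`|V x| `^ p * `|u x| `^ alpha)%:E
       <= C%:E * (stummel_modulus alpha p V r0 `^ p)
          * \int[@lebesgue_rV R n]_(x in eball x0 r0)
              (enorm (grad u x) `^ alpha)%:E)%E.
Proof.
move=> a12 an; move: (a12) => /andP[a1 a2].
have al0 : 0 < alpha by exact: lt_le_trans a1.
have nR : 0 < n%:R :> R by exact: lt_trans an.
have n0 : (0 < n)%N by rewrite -(ltr0n R).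
pose C0 : R := 3 * n%:R * 3 ^+ n.
have C00 : 0 < C0 by rewrite !mulr_gt0// exprn_gt0.
have [K K0 HK] := trace_inequality a12 an C00.
pose s := n%:R - alpha; have s0 : 0 < s by rewrite subr_gt0.
exists (K * (2 * n%:R `^ s)).
split; first by rewrite !mulr_gt0// powR_gt0.
move=> p p1 V [[mV _] Vfin] x0 r r0 u [smu su] suB.
have p0 : 0 < p by exact: lt_le_trans p1.
have [W [N [mW mN N0 VW]]] := borel_version mV.
set mu := @lebesgue_rV R n.
pose q (y : borel_rV R n) := `|W y| `^ p.
have mq : measurable_fun setT q.
  apply: (measurableT_comp (measurable_powR p)); exact: measurableT_comp.
have q0 y : 0 <= q y by exact: powR_ge0.
set eta := (stummel_modulus alpha p V r `^ p)%E.
have eta0 : (0 <= eta)%E by exact: poweR_ge0.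
have etafin : eta \is a fin_num.
  by rewrite ge0_fin_numE//; apply: poweR_lty; exact: Vfin.
pose b := fine eta; have etaE : eta = b%:E by rewrite fineK.
have b0 : 0 <= b by exact: fine_ge0.
have qb x : (\int[mu]_(y in eball x r) (q y / enorm (x - (y : 'rV[R]_n)) `^ s)%:E <= b%:E)%E.
  rewrite -etaE; apply: le_trans (stummel_modulusP alpha r V x p1).
  apply: le_of_eq; apply/esym.
  apply: (ge0_integral_eq_off_null (measurable_eball x r) mN N0).
  - apply/measurable_EFinP; apply: measurable_funM => //.
    rewrite [X in measurable_fun _ X](_ : _ = (fun y : borel_rV R n => enorm (x - (y : 'rV[R]_n)) `^ (- s))).
      exact: (measurableT_comp (measurable_powR _) (measurable_edist x)).
    by apply/funext => y; rewrite powRN.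
  - by move=> y; rewrite lee_fin divr_ge0// powR_ge0.
  - by move=> y; rewrite lee_fin divr_ge0// powR_ge0.
  - by move=> y Ny; rewrite /q VW.
have cu : continuous u by have [] := smu [::].
have cdu i : continuous (partial i u) by have [] := smu [:: i].
have du i x : derivable u x (delta_mx 0 i) by have [_] := smu [::]; apply.
have mu_u : measurable_fun setT (fun x : borel_rV R n => `|u x|).
  by apply: measurableT_comp => //; exact: continuous_measurable_rV.
pose w (y : borel_rV R n) : R := (enorm (x0 - (y : 'rV[R]_n)) < r)%R%:R * q y.
have mass : (\int[mu]_y (w y)%:E <= (r `^ s * b)%:E)%E := weight_mass x0 n0 s0 r0 mq q0 qb.
have pot y : (\int[mu]_z (riesz s y z * w z)%:E <= (2 * n%:R `^ s * b)%:E)%E :=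
  weight_potential x0 n0 s0 r0 mq q0 qb y.
have w0 y : 0 <= w y by rewrite mulr_ge0.
have mw : measurable_fun setT w.
  apply: measurable_funM => //; apply: measurable_fun_bool_real; apply: (measurable_fun_bool true).
  by have := measurable_eball x0 r; congr measurable; apply/seteqP; split=> y /= ; [split|case].
pose f (x : borel_rV R n) := enorm (grad u x).
have lhsE : (\int[mu]_(x in eball x0 r) (`|V x| `^ p * `|u x| `^ alpha)%:E =
    \int[mu]_x (w x * `|u x| `^ alpha)%:E)%E.
  rewrite (ge0_integral_eq_off_null (g := fun x => (q x * `|u x| `^ alpha)%:E) (measurable_eball x0 r) mN N0).
  - rewrite integral_bool_restrict; apply: eq_integral => x _.
    by rewrite /w mulrA.
  - apply/measurable_EFinP; apply: measurable_funM => //.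
    exact: (measurableT_comp (measurable_powR _) mu_u).
  - by move=> x; rewrite lee_fin mulr_ge0 ?powR_ge0.
  - by move=> x; rewrite lee_fin mulr_ge0 ?powR_ge0.
  - by move=> x Nx; rewrite /q VW.
have rhsE : (\int[mu]_(x in eball x0 r) (enorm (grad u x) `^ alpha)%:E =
    \int[mu]_x (f x `^ alpha)%:E)%E.
  rewrite integral_bool_restrict; apply: eq_integral => x _.
  case: (boolP (enorm (x0 - x) < r)) => h; first by rewrite mul1r.
  rewrite mul0r /f grad_not_supp; last by move=> /suB; apply/negP.
  rewrite (_ : enorm 0 = 0) ?powR0 ?gt_eqF//.
  by rewrite /enorm big1 ?sqrtr0// => i _; rewrite mxE expr0n.
rewrite lhsE rhsE etaE.
have [M M0 uM] := compact_supp_bounded cu su.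
have Xle : (\int[mu]_x (w x * `|u x| `^ alpha)%:E <= (M `^ alpha)%:E * (r `^ s * b)%:E)%E.
  have Ma0 : 0 <= M `^ alpha by exact: powR_ge0.
  apply: le_trans (lee_wpmul2l _ mass); last by rewrite lee_fin.
  rewrite -ge0_integralTZl//; last exact/measurable_EFinP.
  apply: ge0_le_integralT.
  - apply/measurable_EFinP; apply: measurable_funM => //.
    exact: (measurableT_comp (measurable_powR _) mu_u).
  - by apply: measurable_funeM; exact/measurable_EFinP.
  - by move=> x; rewrite lee_fin mulr_ge0 ?powR_ge0.
  move=> x; rewrite -EFinM lee_fin mulrC ler_wpM2r//.
  by apply: ge0_ler_powR; rewrite ?nnegrE// ltW.
(* A zero modulus forces the weight to have mass zero. *)
have [b00|bn0] := eqVneq b 0.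
  apply: (le_trans Xle); rewrite b00 mulr0 !mule0 mule_ge0//.
  by apply: integral_ge0 => x _; rewrite lee_fin powR_ge0.
have bpos : 0 < b by rewrite lt_def bn0.
rewrite -EFinM -mulrA; apply: HK => //.
- by rewrite !mulr_gt0// powR_gt0.
- exact: measurable_enorm_grad.
- by move=> x; exact: enorm_ge0.
- by move=> x; exact: subrepresentation.
- by apply: (le_lt_trans Xle); rewrite -EFinM ltry.
Qed.
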